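(* Consider SAS-ADMM with deterministic parameters chosen as $$\eta_k=\min\Big\{\frac{c_1}{m_k(m_k+1)},\,c_2\Big\},\qquad m_k=\max\{\lceil c_3k^{\varrho}\rceil,\,m\},$$ where $c_1,c_3>0$, $0<c_2\le\frac1{2\nu}$, $\varrho\ge1$ and $m\ge1$ is an integer. Fix an integer $\kappa\ge1$ and assume for all $k\ge\kappa$: $\mathcal D_k\succeq\mathcal D_{k+1}\succeq0$ and $\mathbb E\|\delta_t\|_{H^{-1}}^2\le\sigma^2$ for every inner index $t$ of outer iteration $k$ (some constant $\sigma>0$); assume also that $x^\kappa,\breve x^\kappa,y^{\kappa-1},y^\kappa,\lambda^\kappa$ have finite second moments. For $T\ge1$ let $w_T=(x_T;y_T;\lambda_T)=\frac1T\sum_{k=\kappa}^{\kappa+T-1}\tilde w^k$, and define $E_\varrho(T)=1/T$ if $\varrho>1$ and $E_\varrho(T)=(1+\log T)/T$ if $\varrho=1$. Then for every $w^*=(x^*;y^*;\lambda^* )\in\Omega^*$ there is a constant $C>0$ independent of $T$ such that for all $T\ge1$, $$\big|\mathbb E[F(w_T)]-F(w^* )\big|\le C\,E_\varrho(T)\quad\text{and}\quad \mathbb E\|Ax_T+By_T-b\|\le C\,E_\varrho(T).$$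
   Context: Setting. $\mathcal X\subset\mathbb R^{n_1}$, $\mathcal Y\subset\mathbb R^{n_2}$ are nonempty closed convex sets; $A\in\mathbb R^{n\times n_1}$, $B\in\mathbb R^{n\times n_2}$, $b\in\mathbb R^n$; $g:\mathcal Y\to\mathbb R\cup\{+\infty\}$ is proper convex; $f=\frac1N\sum_{j=1}^N f_j$, each $f_j$ real-valued, convex and continuously differentiable on an open set containing $\mathcal X$. The problem is $\min\{f(x)+g(y): x\in\mathcal X,\ y\in\mathcal Y,\ Ax+By=b\}$. $\Omega^*$ denotes its set of primal-dual solutions, i.e. points $w^*=(x^*;y^*;\lambda^* )\in\Omega:=\mathcal X\times\mathcal Y\times\mathbb R^n$ that are saddle points of $\mathcal L(x,y,\lambda)=f(x)+g(y)-\lambda^\top(Ax+By-b)$ on $\Omega$; it is assumed nonempty, and for every $z\in\mathbb R^{n_2}$ the problem $\min_{y\in\mathcal Y}g(y)+\frac12y^\top B^\top By+z^\top y$ is assumed to have a minimizer. A fixed symmetric positive definite $H\in\mathbb R^{n_1\times n_1}$ and a constant $\nu>0$ satisfy $\|\nabla f_j(x_1)-\nabla f_j(x_2)\|_{H^{-1}}\le \nu\|x_1-x_2\|_H$ for all $x_1,x_2\in\mathcal X$ and all $j$. For a symmetric matrix $G$, $\|v\|_G^2:=v^\top G v$; $G_1\succeq G_2$ means $G_1-G_2$ is positive semidefinite. $\mathcal L_\beta(x,y,\lambda)=\mathcal L(x,y,\lambda)+\frac\beta2\|Ax+By-b\|^2$. $\Delta:=\{(\tau,s)\in\mathbb R^2:\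 \tau+s>0,\ \tau\le1,\ -\tau^2-s^2-\tau s+\tau+s+1\ge0\}$. Subroutine xsub. Inputs: $x^k\in\mathcal X$, $\breve x^k$, $h\in\mathbb R^{n_1}$, an integer $m_k\ge1$, $\eta_k>0$, a symmetric matrix $M_k$. Set $x_1=x^k$, $\breve x_1=\breve x^k$. For $t=1,\dots,m_k$: draw $\xi_t$ uniformly from $\{1,\dots,N\}$, independently of everything generated before; set $\beta_t=2/(t+1)$, $\gamma_t=2/(t\eta_k)$, $\hat x_t=\beta_t\breve x_t+(1-\beta_t)x_t$, $d_t=\nabla f_{\xi_t}(\hat x_t)+e_t$ where $e_t$ is a random vector whose conditional expectation given all previously generated random quantities and $\xi_t$ is $0$; $\breve x_{t+1}=\arg\min_{x\in\mathcal X}\{\langle d_t+h,x\rangle+\frac{\gamma_t}2\|x-\breve x_t\|_H^2+\frac12\|x-x^k\|_{M_k}^2\}$; $x_{t+1}=\beta_t\breve x_{t+1}+(1-\beta_t)x_t$. Output $x^{k+1}=x_{m_k+1}$, $\breve x^{k+1}=\breve x_{m_k+1}$. Put $\delta_t=\nabla f(\hat x_t)-d_t$ (inner quantities of outer iteration $k$). Algorithm SAS-ADMM. Parameters: $\beta>0$, the matrix $H$, a symmetric positive semidefinite $L\in\mathbb R^{n_2\times n_2}$, $(\tau,s)\in\Delta$. Start: $(x^0,y^0,\lambda^0)\in\mathcal X\times\mathcal Y\times\mathbb R^n$, $\breve x^0=x^0$. For $k=0,1,\dots$: choose an integer $m_k\ge1$, $\eta_k>0$, and a symmetric $M_k$ with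 $\mathcal D_k:=M_k-\beta A^\top A\succeq0$; set $h^k=-A^\top[\lambda^k-\beta(Ax^k+By^k-b)]$; compute $(x^{k+1},\breve x^{k+1})$ by xsub with inputs $x^k,\breve x^k,h^k,m_k,\eta_k,M_k$; $\lambda^{k+1/2}=\lambda^k-\tau\beta(Ax^{k+1}+By^k-b)$; $y^{k+1}\in\arg\min_{y\in\mathcal Y}\mathcal L_\beta(x^{k+1},y,\lambda^{k+1/2})+\frac12\|y-y^k\|_L^2$; $\lambda^{k+1}=\lambda^{k+1/2}-s\beta(Ax^{k+1}+By^{k+1}-b)$. Notation. $F(w)=f(x)+g(y)$ for $w=(x;y;\lambda)$; $\tilde\lambda^k=\lambda^k-\beta(Ax^{k+1}+By^k-b)$; $\tilde w^k=(x^{k+1};y^{k+1};\tilde\lambda^k)$. *)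

(* Defs.v *)
From HB Require Import structures.
From mathcomp Require Import all_boot all_order all_algebra.
From mathcomp Require Import all_classical all_reals all_analysis.

Set Implicit Arguments.
Unset Strict Implicit.
Unset Printing Implicit Defensive.

Import Order.TTheory GRing.Theory Num.Theory.
Import numFieldNormedType.Exports.
Local Open Scope classical_set_scope.
Local Open Scope ring_scope.

Section LinAlg.
Variable R : realType.

Definition ip n (u v : 'cV[R]_n) : R := (u^T *m v) 0 0.
Definition vnorm n (v : 'cV[R]_n) : R := Num.sqrt (ip v v).
Definition gnorm2 n (G : 'M[R]_n) (v : 'cV[R]_n) : R := (v^T *m G *m v) 0 0.

Definition sym_mx n (G : 'M[R]_n) : Prop := G^T = G.
Definition psd n (G : 'M[R]_n) : Prop := sym_mx G /\ forall v, 0 <= gnorm2 G v.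
Definition pd n (G : 'M[R]_n) : Prop :=
  sym_mx G /\ forall v : 'cV[R]_n, v != 0 -> 0 < gnorm2 G v.
Definition loewner_ge n (G1 G2 : 'M[R]_n) : Prop := psd (G1 - G2).

Definition convex_on n (S : set 'cV[R]_n) (f : 'cV[R]_n -> R) : Prop :=
  forall a b (t : R), S a -> S b -> 0 <= t <= 1 ->
    f (t *: a + (1 - t) *: b) <= t * f a + (1 - t) * f b.

Definition proper_convex_on n (S : set 'cV[R]_n) (g : 'cV[R]_n -> \bar R) : Prop :=
  [/\ (forall y, S y -> g y != -oo%E),
      (exists y, S y /\ g y \is a fin_num) &
      (forall a b (t : R), S a -> S b -> 0 <= t <= 1 ->
        (g (t *: a + (1 - t) *: b)%R <= t%:E * g a + (1 - t)%:E * g b)%E)].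

Definition grad n (f : 'cV[R]_n -> R^o) (x : 'cV[R]_n) : 'cV[R]_n :=
  \col_i ('d f x (delta_mx i 0)).

Definition C1_near n (S : set 'cV[R]_n) (f : 'cV[R]_n -> R^o) : Prop :=
  exists U : set 'cV[R]_n, [/\ open U, S `<=` U,
    (forall x, U x -> differentiable f x) &
    (forall x, U x -> {for x, continuous (grad f)})].

Definition is_argmin (V : Type) (S : set V) (phi : V -> R) (z : V) : Prop :=
  S z /\ forall z', S z' -> phi z <= phi z'.
Definition is_argmin_ext (V : Type) (S : set V) (phi : V -> \bar R) (z : V) : Prop :=
  S z /\ forall z', S z' -> (phi z <= phi z')%E.

End LinAlg.

Section Problem.
Variables (R : realType) (n1 n2 n N : nat).
Variables (A : 'M[R]_(n, n1)) (B : 'M[R]_(n, n2)) (b : 'cV[R]_n).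
Variables (fs : 'I_N -> 'cV[R]_n1 -> R) (g : 'cV[R]_n2 -> \bar R).

Definition favg (x : 'cV[R]_n1) : R := N%:R^-1 * \sum_(j < N) fs j x.

Definition Fobj (x : 'cV[R]_n1) (y : 'cV[R]_n2) : \bar R := ((favg x)%:E + g y)%E.

Definition resid (x : 'cV[R]_n1) (y : 'cV[R]_n2) : 'cV[R]_n := A *m x + B *m y - b.

Definition Lag (x : 'cV[R]_n1) (y : 'cV[R]_n2) (lam : 'cV[R]_n) : \bar R :=
  (Fobj x y - (ip lam (resid x y))%:E)%E.

Definition Lagb (beta : R) (x : 'cV[R]_n1) (y : 'cV[R]_n2) (lam : 'cV[R]_n) : \bar R :=
  (Lag x y lam + (beta / 2 * vnorm (resid x y) ^+ 2)%:E)%E.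

Definition saddle_point (X : set 'cV[R]_n1) (Y : set 'cV[R]_n2)
    (xs : 'cV[R]_n1) (ys : 'cV[R]_n2) (ls : 'cV[R]_n) : Prop :=
  [/\ X xs, Y ys &
      forall x y lam, X x -> Y y ->
        (Lag xs ys lam <= Lag xs ys ls)%E /\ (Lag xs ys ls <= Lag x y ls)%E].

End Problem.

Section Params.
Variable R : realType.

Definition mk (c3 rho : R) (m : nat) (k : nat) : nat :=
  maxn `|Num.ceil (c3 * (k%:R `^ rho))|%N m.

Definition etak (c1 c2 c3 rho : R) (m : nat) (k : nat) : R :=
  Num.min (c1 / ((mk c3 rho m k)%:R * (mk c3 rho m k).+1%:R)) c2.

Definition Erho (rho : R) (T : nat) : R :=
  if 1 < rho then T%:R^-1 else (1 + ln T%:R) / T%:R.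

Definition in_Delta (tau s : R) : Prop :=
  [/\ 0 < tau + s, tau <= 1 & 0 <= - tau ^+ 2 - s ^+ 2 - tau * s + tau + s + 1].

End Params.

Section Randomness.
Variables (R : realType) (d : measure_display) (T : measurableType d).

Definition rvec n (v : T -> 'cV[R]_n) : Prop :=
  forall i, measurable_fun setT (fun w => v w i 0).

Definition vec_events n (v : T -> 'cV[R]_n) : set (set T) :=
  [set E | exists i (Bs : set R), measurable Bs /\ E = (fun w => v w i 0) @^-1` Bs].

Definition idx_events N (xi : T -> 'I_N) : set (set T) :=
  [set E | exists j, E = [set w | xi w = j]].

End Randomness.

Definition before (k' t' k t : nat) : bool :=
  (k' < k)%N || ((k' == k) && (t' < t)%N).

Section History.
Variables (R : realType) (d : measure_display) (T : measurableType d).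
Variables (n1 n2 n N : nat) (mkf : nat -> nat).
Variables (xi : nat -> nat -> T -> 'I_N) (e : nat -> nat -> T -> 'cV[R]_n1).
Variables (x xb : nat -> T -> 'cV[R]_n1) (y : nat -> T -> 'cV[R]_n2)
          (lam : nat -> T -> 'cV[R]_n).
Variables (xs xbs : nat -> nat -> T -> 'cV[R]_n1).

(* generators of the sigma-algebra of all random quantities generated before
   the draw of xi_t in inner iteration t of outer iteration k *)
Definition past_gen (k t : nat) : set (set T) :=
  [set E | exists k' t', [/\ before k' t' k t, (1 <= t' <= mkf k')%N &
                           vec_events (e k' t') E \/ idx_events (xi k' t') E]]
  `|` [set E | exists j, (j <= k)%N /\
         [\/ vec_events (x j) E, vec_events (xb j) E,
             vec_events (y j) E | vec_events (lam j) E]]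
  `|` [set E | exists s, (1 <= s <= t)%N /\
         (vec_events (xs k s) E \/ vec_events (xbs k s) E)].

Definition past (k t : nat) : set (set T) := <<s past_gen k t >>.
Definition past_xi (k t : nat) : set (set T) :=
  <<s past_gen k t `|` idx_events (xi k t) >>.

End History.

Section Algorithm.
Variables (R : realType) (T : Type).
Variables (n1 n2 n N : nat).
Variables (X : set 'cV[R]_n1) (Y : set 'cV[R]_n2).
Variables (A : 'M[R]_(n, n1)) (B : 'M[R]_(n, n2)) (b : 'cV[R]_n).
Variables (fs : 'I_N -> 'cV[R]_n1 -> R) (g : 'cV[R]_n2 -> \bar R).
Variables (H : 'M[R]_n1) (beta : R) (L : 'M[R]_n2) (tau s : R).
Variables (mkf : nat -> nat) (eta : nat -> R) (M : nat -> 'M[R]_n1).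
Variables (xi : nat -> nat -> T -> 'I_N) (e : nat -> nat -> T -> 'cV[R]_n1).
Variables (x xb : nat -> T -> 'cV[R]_n1) (y : nat -> T -> 'cV[R]_n2)
          (lam : nat -> T -> 'cV[R]_n).
Variables (xs xbs : nat -> nat -> T -> 'cV[R]_n1).

Definition beta_t (t : nat) : R := 2 / (t%:R + 1).
Definition gamma_t (k t : nat) : R := 2 / (t%:R * eta k).
Definition xhat (k t : nat) (w : T) : 'cV[R]_n1 :=
  beta_t t *: xbs k t w + (1 - beta_t t) *: xs k t w.
Definition dir (k t : nat) (w : T) : 'cV[R]_n1 :=
  grad (fs (xi k t w)) (xhat k t w) + e k t w.
Definition delta (k t : nat) (w : T) : 'cV[R]_n1 :=
  grad (favg fs) (xhat k t w) - dir k t w.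
Definition hk (k : nat) (w : T) : 'cV[R]_n1 :=
  - (A^T *m (lam k w - beta *: (A *m x k w + B *m y k w - b))).
Definition lam_half (k : nat) (w : T) : 'cV[R]_n :=
  lam k w - (tau * beta) *: (A *m x k.+1 w + B *m y k w - b).

Definition sas_admm_run (x0 : 'cV[R]_n1) (y0 : 'cV[R]_n2) (lam0 : 'cV[R]_n) : Prop :=
  forall w : T,
  [/\ [/\ x 0 w = x0, xb 0 w = x0, y 0 w = y0 & lam 0 w = lam0],
      (forall k, xs k 1 w = x k w /\ xbs k 1 w = xb k w),
      (forall k t, (1 <= t <= mkf k)%N ->
         is_argmin X (fun z => ip (dir k t w + hk k w) z
                               + gamma_t k t / 2 * gnorm2 H (z - xbs k t w)
                               + 1 / 2 * gnorm2 (M k) (z - x k w))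
                   (xbs k t.+1 w)
         /\ xs k t.+1 w = beta_t t *: xbs k t.+1 w + (1 - beta_t t) *: xs k t w),
      (forall k, x k.+1 w = xs k (mkf k).+1 w /\ xb k.+1 w = xbs k (mkf k).+1 w) &
      (forall k,
         is_argmin_ext Y (fun z => (Lagb A B b fs g beta (x k.+1 w) z (lam_half k w)
                                    + (1 / 2 * gnorm2 L (z - y k w))%:E)%E)
                       (y k.+1 w)
         /\ lam k.+1 w = lam_half k w
                         - (s * beta) *: (A *m x k.+1 w + B *m y k.+1 w - b))].

End Algorithm.

(* Main.v *)
Require Import Defs.
From HB Require Import structures.
From mathcomp Require Import all_boot all_order all_algebra.
From mathcomp Require Import all_classical all_reals all_analysis.
From mathcomp Require Import measurable_realfun ring lra.
Set Implicit Arguments.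
Unset Strict Implicit.
Unset Printing Implicit Defensive.
Import Order.TTheory GRing.Theory Num.Theory.
Import numFieldNormedType.Exports.
Local Open Scope classical_set_scope.
Local Open Scope ring_scope.

(** For a multiplier [l], a quadratic potential in the distances of the iterates
    to [(xst, yst, l)] decreases along each run, up to the noise of the inner loop:
      gap_k(l) + potential_(k+1)(l) <= potential_k(l) + noise_k,
    where [gap_k(l)] is the Lagrangian excess of [(x_(k+1), y_(k+1))] at [l] and the
    region Delta is what makes the remaining cross terms nonnegative.  Summing,
    averaging by convexity and taking [l = lst - r / |r|], with [r] the residual of
    the averaged point, bounds [|r|], and with it [|F - F*|], by the average of the
    initial potential and the noise, on every sample path.  All square moments stay
    finite along the run, so the term of the noise that is linear in [delta] has mean
    zero, since [delta] is orthogonal to the past; the quadratic term has mean at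
    most [sigma^2 c1 / m_k], whose sum over [k] is bounded for [rho > 1] and
    logarithmic for [rho = 1]. *)

(** The multiplier [lst - r / |r|] is random, so expectations cannot be taken in the one-step
    inequality at a fixed multiplier. The inequality is kept pathwise: the potential at [kappa] is
    bounded uniformly over the unit ball around [lst], the noise does not involve the multiplier,
    and the expectation is taken once, at the end. Moments are assumed at [kappa] only, while the
    linear noise needs them at every later step. They propagate because each subproblem bounds the
    distance of its solution to the saddle point by the data of the step; for y this holds only for
    [B y] and the [L]-seminorm, so the invariant concerns these rather than y itself. In the
    one-step inequality the squared residual carries a factor 1 - s that may be negative. Comparing
    two successive y-steps repairs this, and the polynomial defining Delta is exactly the
    coefficient of the squared residual that then remains. The zero mean of the noise is given
    through events of the past; expanding the random index over its N values turns each summand into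
    a past-measurable factor times a centred one. *)

Lemma addmxE (V : nmodType) m n (A B : 'M[V]_(m, n)) i j : (A + B) i j = A i j + B i j.
Proof. by rewrite mxE. Qed.

Lemma oppmxE (V : zmodType) m n (A : 'M[V]_(m, n)) i j : (- A) i j = - A i j.
Proof. by rewrite mxE. Qed.

Lemma scalemxE (V : pzRingType) m n (A : 'M[V]_(m, n)) c i j : (c *: A) i j = c * A i j.
Proof. by rewrite mxE. Qed.

Ltac mxring := apply/matrixP => ? ?; rewrite !(addmxE, oppmxE, scalemxE); ring.

(** * Inner products, weighted norms and Young inequalities *)

Section InnerProduct.
Variable R : realType.
Implicit Types n : nat.

Lemma ipE n (u v : 'cV[R]_n) : ip u v = \sum_i u i 0 * v i 0.
Proof. by rewrite /ip mxE; apply: eq_bigr => i _; rewrite mxE. Qed.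

Lemma ipC n (u v : 'cV[R]_n) : ip u v = ip v u.
Proof. by rewrite !ipE; apply: eq_bigr => i _; rewrite mulrC. Qed.

Lemma ipDl n (u v w : 'cV[R]_n) : ip (u + v) w = ip u w + ip v w.
Proof. by rewrite /ip linearD mulmxDl mxE. Qed.

Lemma ipDr n (u v w : 'cV[R]_n) : ip w (u + v) = ip w u + ip w v.
Proof. by rewrite /ip mulmxDr mxE. Qed.

Lemma ipNl n (u v : 'cV[R]_n) : ip (- u) v = - ip u v.
Proof. by rewrite /ip linearN mulNmx mxE. Qed.

Lemma ipNr n (u v : 'cV[R]_n) : ip u (- v) = - ip u v.
Proof. by rewrite /ip mulmxN mxE. Qed.

Lemma ipZl n c (u v : 'cV[R]_n) : ip (c *: u) v = c * ip u v.
Proof. by rewrite /ip linearZ -scalemxAl mxE. Qed.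

Lemma ipZr n c (u v : 'cV[R]_n) : ip u (c *: v) = c * ip u v.
Proof. by rewrite /ip -scalemxAr mxE. Qed.

Lemma ip0l n (v : 'cV[R]_n) : ip 0 v = 0.
Proof. by rewrite /ip linear0 mul0mx mxE. Qed.

Lemma ip_suml n I (r : seq I) (F : I -> 'cV[R]_n) v :
  ip (\sum_(i <- r) F i) v = \sum_(i <- r) ip (F i) v.
Proof. by elim/big_rec2 : _ => [|i a b _ <-]; rewrite ?ip0l// ipDl. Qed.

Lemma ip_ge0 n (u : 'cV[R]_n) : 0 <= ip u u.
Proof. by rewrite ipE sumr_ge0// => i _; rewrite -expr2 sqr_ge0. Qed.

Lemma ip_eq0 n (u : 'cV[R]_n) : (ip u u == 0) = (u == 0).
Proof.
apply/eqP/eqP => [|->]; last by rewrite ip0l.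
rewrite ipE => /eqP; rewrite psumr_eq0; last by move=> i _; rewrite -expr2 sqr_ge0.
move=> /allP u0; apply/matrixP => i j; rewrite ord1 mxE.
by move: (u0 i); rewrite mem_index_enum => /(_ isT); rewrite -expr2 sqrf_eq0 => /eqP.
Qed.

Lemma vnormE n (u : 'cV[R]_n) : vnorm u ^+ 2 = ip u u.
Proof. by rewrite /vnorm sqr_sqrtr ?ip_ge0. Qed.

Lemma vnorm_ge0 n (u : 'cV[R]_n) : 0 <= vnorm u.
Proof. exact: sqrtr_ge0. Qed.

Lemma ip_mulmx n p (A : 'M[R]_(n, p)) u v : ip (A *m u) v = ip u (A^T *m v).
Proof. by rewrite /ip trmx_mul mulmxA. Qed.

Lemma gnorm2E n (G : 'M[R]_n) v : gnorm2 G v = ip v (G *m v).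
Proof. by rewrite /gnorm2 /ip mulmxA. Qed.

Lemma gnorm2_mulmx n p (A : 'M[R]_(n, p)) v : gnorm2 (A^T *m A) v = ip (A *m v) (A *m v).
Proof. by rewrite gnorm2E ip_mulmx mulmxA. Qed.

Lemma ip_sym n (G : 'M[R]_n) u v : sym_mx G -> ip (G *m u) v = ip u (G *m v).
Proof. by move=> sG; rewrite ip_mulmx sG. Qed.

Lemma ip_young n (u v : 'cV[R]_n) (c : R) : 0 < c ->
  ip u v <= c / 2 * ip u u + 1 / (2 * c) * ip v v.
Proof.
move=> c0; have := ip_ge0 (c *: u - v).
rewrite ipDl !ipDr !ipNl !ipNr !ipZl !ipZr (ipC v u) => h.
rewrite -subr_ge0 [leRHS](_ : _ = (2 * c)^-1 *
  (c * (c * ip u u) + - (c * ip u v) + (- (c * ip u v) + - - ip v v))).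
  by rewrite mulr_ge0// invr_ge0 mulr_ge0// ltW.
by field; rewrite gt_eqF.
Qed.

Lemma ip_cauchy n (u v : 'cV[R]_n) : `|ip u v| <= vnorm u * vnorm v.
Proof.
have key (w z : 'cV[R]_n) : ip w z <= vnorm w * vnorm z.
  have := vnorm_ge0 w; have := vnorm_ge0 z.
  rewrite le_eqVlt => /predU1P[/esym z0 _|z0].
    suff -> : z = 0 by rewrite ipC ip0l mulr_ge0// vnorm_ge0.
    by apply/eqP; rewrite -ip_eq0 -vnormE z0 expr0n.
  rewrite le_eqVlt => /predU1P[/esym w0|w0].
    suff -> : w = 0 by rewrite ip0l mulr_ge0// vnorm_ge0.
    by apply/eqP; rewrite -ip_eq0 -vnormE w0 expr0n.
  (* This weight makes the two terms of Young's inequality equal. *)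
  apply: (le_trans (@ip_young _ w z (vnorm z / vnorm w) _)); first exact: divr_gt0.
  rewrite -!vnormE le_eqVlt; apply/orP; left; apply/eqP; field.
  by rewrite !gt_eqF.
rewrite ler_norml key andbT lerNl -ipNl (le_trans (key _ _))//.
by rewrite /vnorm ipNl ipNr opprK.
Qed.

Lemma ip_sqrD_le n (u v : 'cV[R]_n) : ip (u + v) (u + v) <= 2 * ip u u + 2 * ip v v.
Proof.
have := ip_ge0 (u - v); rewrite !(ipDl, ipDr, ipNl, ipNr) (ipC v u) => h.
lra.
Qed.

Lemma sym_invmx n (G : 'M[R]_n) : sym_mx G -> sym_mx (invmx G).
Proof. by rewrite /sym_mx trmx_inv => ->. Qed.

Lemma gnorm2D n (G : 'M[R]_n) (u v : 'cV[R]_n) : sym_mx G ->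
  gnorm2 G (u + v) = gnorm2 G u + 2 * ip u (G *m v) + gnorm2 G v.
Proof.
move=> sG; rewrite !gnorm2E mulmxDr !ipDl !ipDr -[ip v (G *m u)]ip_sym//.
by rewrite (ipC _ u); ring.
Qed.

Lemma gnorm2Z n (G : 'M[R]_n) (c : R) (u : 'cV[R]_n) : gnorm2 G (c *: u) = c ^+ 2 * gnorm2 G u.
Proof. by rewrite !gnorm2E -scalemxAr ipZl ipZr; ring. Qed.

Lemma gnorm2N n (G : 'M[R]_n) (u : 'cV[R]_n) : gnorm2 G (- u) = gnorm2 G u.
Proof. by rewrite !gnorm2E mulmxN ipNl ipNr opprK. Qed.

Lemma gnorm2_sub n (G1 G2 : 'M[R]_n) v : gnorm2 (G1 - G2) v = gnorm2 G1 v - gnorm2 G2 v.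
Proof. by rewrite !gnorm2E mulmxBl ipDr ipNr. Qed.

Lemma gnorm2_scale n c (G : 'M[R]_n) v : gnorm2 (c *: G) v = c * gnorm2 G v.
Proof. by rewrite !gnorm2E -scalemxAl ipZr. Qed.

Lemma gnorm2_three_points n (G : 'M[R]_n) (a b c : 'cV[R]_n) : sym_mx G ->
  ip (G *m (a - b)) (a - c) =
  1 / 2 * (gnorm2 G (a - c) - gnorm2 G (b - c) + gnorm2 G (a - b)).
Proof.
move=> sG; have -> : b - c = (a - c) - (a - b) by mxring.
rewrite (@gnorm2D _ _ (a - c) (- (a - b)))// gnorm2N mulmxN ipNr ipC; lra.
Qed.

Lemma gnorm2_convex n (G : 'M[R]_n) (u v : 'cV[R]_n) (t : R) : psd G -> 0 <= t <= 1 ->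
  gnorm2 G (t *: u + (1 - t) *: v) <= t * gnorm2 G u + (1 - t) * gnorm2 G v.
Proof.
move=> [sG pG] /andP[t0 t1]; rewrite -subr_ge0.
have := pG (u - v); rewrite !gnorm2D// !gnorm2N mulmxN ipNr !gnorm2Z -scalemxAr ipZl ipZr.
move=> h; rewrite [leRHS](_ : _ = t * (1 - t) *
  (gnorm2 G u + 2 * - ip u (G *m v) + gnorm2 G v)); last by ring.
by rewrite !mulr_ge0// subr_ge0.
Qed.

Lemma pd_psd n (G : 'M[R]_n) : pd G -> psd G.
Proof.
move=> [sG pG]; split=> // v; have [->|v0] := eqVneq v 0; last exact/ltW/pG.
by rewrite gnorm2E ip0l.
Qed.

(** A row of the left kernel, transposed, is a vector on which the quadratic form vanishes, so it
    must be zero. *)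
Lemma pd_unitmx n (G : 'M[R]_n) : pd G -> G \in unitmx.
Proof.
move=> [sG pG]; rewrite -row_free_unit -kermx_eq0.
rewrite /sym_mx in sG.
apply/eqP/row_matrixP => i; rewrite row0; apply: trmx_inj; rewrite trmx0.
apply/eqP/negPn/negP => /pG; rewrite gnorm2E -[X in X *m _]sG -trmx_mul -row_mul mulmx_ker.
by rewrite row0 trmx0 ipC ip0l ltxx.
Qed.

Lemma psd_invmx n (G : 'M[R]_n) : pd G -> psd (invmx G).
Proof.
move=> pG; split; first by apply: sym_invmx; case: pG.
move=> v; have -> : v = G *m (invmx G *m v) by rewrite mulmxA mulmxV ?mul1mx ?pd_unitmx.
rewrite gnorm2E [X in ip _ X]mulmxA mulVmx ?pd_unitmx// mul1mx ip_sym; last by case: pG.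
by rewrite -gnorm2E; apply: (pd_psd _).2.
Qed.

(** Expand the squared [G]-norm of c v - G^-1 g and divide by 2c. The dual norm [invmx G] is the one
    in which gradients and noise are measured. *)
Lemma pd_young n (G : 'M[R]_n) (g v : 'cV[R]_n) (c : R) : pd G -> 0 < c ->
  ip g v <= c / 2 * gnorm2 G v + 1 / (2 * c) * gnorm2 (invmx G) g.
Proof.
move=> pG c0; have sG : sym_mx G by case: pG.
have uG := pd_unitmx pG.
have := (pd_psd pG).2 (c *: v - invmx G *m g).
rewrite gnorm2D// gnorm2N gnorm2Z mulmxN ipNr [G *m (_ *m _)]mulmxA mulmxV// mul1mx.
rewrite ipZl [gnorm2 G (_ *m _)]gnorm2E [G *m (_ *m _)]mulmxA mulmxV// mul1mx.
rewrite ip_sym; last exact: sym_invmx.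
rewrite -gnorm2E (ipC v) => h; rewrite -subr_ge0.
rewrite [leRHS](_ : _ = (2 * c)^-1 *
 (c ^+ 2 * gnorm2 G v + 2 * - (c * ip g v) + gnorm2 (invmx G) g)).
  by rewrite mulr_ge0// invr_ge0 mulr_ge0// ltW.
by field; rewrite gt_eqF.
Qed.

Lemma pd_invmx n (G : 'M[R]_n) : pd G -> pd (invmx G).
Proof.
move=> pG; split; first by apply: sym_invmx; case: pG.
move=> v v0; have vE : v = G *m (invmx G *m v) by rewrite mulmxA mulmxV ?mul1mx ?pd_unitmx.
have sG : sym_mx G by case: pG.
rewrite gnorm2E {1}vE ip_sym// [X in ip _ X](_ : _ = G *m (invmx G *m v)).
  rewrite -gnorm2E; apply: pG.2; apply: contraNneq v0 => h.
  by rewrite vE h mulmx0.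
by [].
Qed.

(* Testing the dual inequality against [v_i e_i] bounds each coordinate. *)
Lemma pd_coord_le n (G : 'M[R]_n) (v : 'cV[R]_n) i : pd G ->
  v i 0 ^+ 2 <= (gnorm2 (invmx G) (delta_mx i 0) + 1) * gnorm2 G v.
Proof.
move=> pG; set k := gnorm2 _ _; have k0 : 0 <= k by exact: (psd_invmx pG).2.
have c0 : 0 < k + 1 by rewrite ltr_wpDl.
have := pd_young (v i 0 *: delta_mx i 0) v pG c0.
have -> : ip (v i 0 *: delta_mx i 0) v = v i 0 ^+ 2.
  rewrite ipZl ipE (bigD1 i)//= mxE !eqxx mul1r big1 ?addr0 ?expr2// => j ji.
  by rewrite mxE (negbTE ji) mul0r.
rewrite gnorm2Z -/k; have sq := sqr_ge0 (v i 0).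
have h : 1 / (2 * (k + 1)) * (v i 0 ^+ 2 * k) <= v i 0 ^+ 2 / 2.
  rewrite mulrC mulrA ler_pdivrMr ?mulr_gt0//.
  rewrite mulr1 mulrA divfK// ler_wpM2l//; lra.
lra.
Qed.

Lemma coord_ip n (v : 'cV[R]_n) i : v i 0 ^+ 2 <= ip v v.
Proof.
rewrite ipE (bigD1 i)//= -expr2 lerDl sumr_ge0// => j _.
by rewrite -expr2 sqr_ge0.
Qed.

End InnerProduct.

(** * First-order optimality over convex sets *)

Section FirstOrder.
Variable R : realType.

Lemma convex_setP n (X : set 'cV[R]_n) (a b : 'cV[R]_n) (t : R) : convex_set X -> X a -> X b ->
  0 <= t <= 1 -> X (t *: a + (1 - t) *: b).
Proof.
move=> cX Xa Xb /andP[t0 t1].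
by have /set_mem := cX a b (Itv01 t0 t1) (mem_set Xa) (mem_set Xb).
Qed.

Lemma convex_set_segment n (X : set 'cV[R]_n) (a b : 'cV[R]_n) (t : R) : convex_set X -> X a -> X b ->
  0 <= t <= 1 -> X (a + t *: (b - a)).
Proof.
move=> cX Xa Xb t01; have := convex_setP cX Xb Xa t01.
by congr X; mxring.
Qed.

(** For small t the linear term dominates. If a < 0, the witness t = -a / (|c| + 1 - a) lies in (0,
    1] and satisfies a + t |c| < 0. *)
Lemma ge0_of_small (a c : R) : (forall t, 0 < t <= 1 -> 0 <= t * a + t ^+ 2 * c) -> 0 <= a.
Proof.
move=> h; rewrite leNgt; apply/negP => a0.
have d0 : 0 < `|c| + 1 - a by rewrite subr_gt0 (lt_trans a0)// ltr_wpDl.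
have t0 : 0 < - a / (`|c| + 1 - a) by rewrite divr_gt0// oppr_gt0.
have t1 : - a / (`|c| + 1 - a) <= 1.
  by rewrite ler_pdivrMr// mul1r lerDr addr_ge0.
have := h _ (introT andP (conj t0 t1)).
set t := _ / _; rewrite expr2 -mulrA -mulrDr pmulr_rge0// leNgt => /negP; apply.
apply: (@le_lt_trans _ _ (a + t * `|c|)).
  by rewrite lerD2l ler_wpM2l ?ler_norm// ltW.
rewrite -ltrBrDl add0r /t mulrAC -mulrA gtr_pMr ?oppr_gt0// ltr_pdivrMr// mul1r.
lra.
Qed.

(** Compare [z] with z + t (x - z): the objective is quadratic, so its increment is t times the
    pairing below plus a multiple of t^2, which disappears for small t. *)
Lemma prox_optimality n (X : set 'cV[R]_n) (G1 G2 : 'M[R]_n) (c u1 u2 : 'cV[R]_n) (a1 : R) z x :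
  convex_set X -> sym_mx G1 -> sym_mx G2 ->
  is_argmin X (fun z => ip c z + a1 / 2 * gnorm2 G1 (z - u1) + 1 / 2 * gnorm2 G2 (z - u2)) z ->
  X x -> 0 <= ip (c + a1 *: (G1 *m (z - u1)) + G2 *m (z - u2)) (x - z).
Proof.
move=> cX s1 s2 [Xz zmin] Xx.
apply: (@ge0_of_small _ (a1 / 2 * gnorm2 G1 (x - z) + 1 / 2 * gnorm2 G2 (x - z))) => t /andP[t0 t1].
have Xt : X (z + t *: (x - z)).
  by apply: convex_set_segment => //; rewrite (ltW t0) t1.
have := zmin _ Xt; rewrite -subr_ge0.
rewrite [X in gnorm2 G1 X](_ : _ = (z - u1) + t *: (x - z)); last by mxring.
rewrite [X in gnorm2 G2 X](_ : _ = (z - u2) + t *: (x - z)); last by mxring.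
rewrite (@gnorm2D _ _ G1 (z - u1))// (@gnorm2D _ _ G2 (z - u2))// !gnorm2Z.
rewrite ipDr -!scalemxAr !ipZr (ipDl (c + _)) (ipDl c) ipZl.
rewrite -(ip_sym (z - u1) (x - z) s1) -(ip_sym (z - u2) (x - z) s2).
lra.
Qed.

(** No derivative of [g] is available: along the segment its increment is bounded by convexity,
    while the smooth part [phi] enters through an exact second-order expansion. *)
Lemma prox_optimality_ext n (Y : set 'cV[R]_n) (g : 'cV[R]_n -> \bar R)
   (phi : 'cV[R]_n -> R) (grd : 'cV[R]_n) (c : 'cV[R]_n -> R) (z x : 'cV[R]_n) :
  convex_set Y -> proper_convex_on Y g ->
  is_argmin_ext Y (fun z => g z + (phi z)%:E)%E z ->
  (forall x t, phi (z + t *: (x - z)) = phi z + t * ip grd (x - z) + t ^+ 2 * c x) ->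
  Y x -> g x \is a fin_num ->
  g z \is a fin_num /\ 0 <= fine (g x) - fine (g z) + ip grd (x - z).
Proof.
move=> cY [gY [y1 [Yy1 gy1]] gc] [Yz zmin] hphi Yx gx.
have gz : g z \is a fin_num.
  (* The minimizer is compared with a point where [g] is finite, which excludes the value +oo. *)
  rewrite fin_numE gY//=; have := zmin _ Yy1.
  by apply: contraTneq => ->; rewrite -(fineK gy1) -EFinD.
split=> //; apply: (@ge0_of_small _ (c x)) => t /andP[t0 t1].
have t01 : 0 <= t <= 1 by rewrite (ltW t0) t1.
have := zmin _ (convex_set_segment cY Yz Yx t01).
have -> : z + t *: (x - z) = t *: x + (1 - t) *: z by mxring.
move=> /le_trans => /(_ _ (leeD2r _ (gc _ _ _ Yx Yz t01))).
rewrite -(fineK gx) -(fineK gz) -!EFinM -!EFinD lee_fin.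
have -> : t *: x + (1 - t) *: z = z + t *: (x - z) by mxring.
rewrite hphi; lra.
Qed.

End FirstOrder.

(** * One accelerated stochastic gradient step *)

Section InnerStep.
Variables (R : realType) (n : nat) (H M : 'M[R]_n).
Hypotheses (pdH : pd H) (psdM : psd M).
Variables (f : 'cV[R]_n -> R) (xst xk h : 'cV[R]_n).

(** The linear and proximal part enters through its gradient at [z] paired with z - xst, not through
    its values: this is the form that the outer analysis consumes. By the three-point identity the
    pairing is still convex in [z]. *)
Definition inner_gap (z : 'cV[R]_n) : R :=
  f z - f xst + ip (h + M *m (z - xk)) (z - xst).

(** [G] stands for the exact gradient at [xh] and [dd] for the direction used. Optimality of [z]
    yields -gam/2 times the squared [H]-distance from [z] to [xb]. Young's inequality for G - dd
    against z - xb spends half of it, and nu bt <= gam/2 lets the curvature term of the descent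
    inequality spend the rest. The noise paired with xb - xst is left alone, because [xb] precedes
    the draw. *)
Lemma inner_step_convex (x xb z G dd : 'cV[R]_n) (bt gam nu : R) :
  let xh := bt *: xb + (1 - bt) *: x in
  let xp := bt *: z + (1 - bt) *: x in
  0 <= bt <= 1 -> 0 < gam -> nu * bt <= gam / 2 ->
  f xp <= f xh + ip G (xp - xh) + nu / 2 * gnorm2 H (xp - xh) ->
  f xh + ip G (x - xh) <= f x ->
  f xh + ip G (xst - xh) <= f xst ->
  0 <= ip (dd + h + gam *: (H *m (z - xb)) + M *m (z - xk)) (xst - z) ->
  inner_gap xp <= (1 - bt) * inner_gap x
     + bt * (gam / 2 * (gnorm2 H (xb - xst) - gnorm2 H (z - xst))
             + ip (G - dd) (xb - xst) + 1 / gam * gnorm2 (invmx H) (G - dd)).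
Proof.
move=> xh xp b01 g0 nub h1 h2 h3; have /andP[b0 b1] := b01.
have [sH pH] := pd_psd pdH; have [sM pM] := psdM.
have exh : xp - xh = bt *: (z - xb) by rewrite /xp /xh; mxring.
rewrite [ip (_ + _ + _ + _) _](_ : _ = - ip dd (z - xst) - ip h (z - xst)
    - gam * ip (H *m (z - xb)) (z - xst) - ip (M *m (z - xk)) (z - xst)); last first.
  by rewrite -(opprB z) ipNr !ipDl ipZl; ring.
rewrite gnorm2_three_points// => h4.
have yg := @pd_young _ _ H (G - dd) (z - xb) (gam / 2) pdH (divr_gt0 g0 (ltr0Sn _ 1)).
have cvx : ip (h + M *m (xp - xk)) (xp - xst) <=
   bt * ip (h + M *m (z - xk)) (z - xst) + (1 - bt) * ip (h + M *m (x - xk)) (x - xst).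
  rewrite !ipDl !gnorm2_three_points//.
  have := gnorm2_convex (z - xst) (x - xst) psdM b01.
  have := gnorm2_convex (z - xk) (x - xk) psdM b01.
  have -> : bt *: (z - xst) + (1 - bt) *: (x - xst) = xp - xst by rewrite /xp; mxring.
  have -> : bt *: (z - xk) + (1 - bt) *: (x - xk) = xp - xk by rewrite /xp; mxring.
  have -> : ip h (xp - xst) = bt * ip h (z - xst) + (1 - bt) * ip h (x - xst).
    by rewrite /xp -!ipZr -ipDr; congr ip; mxring.
  lra.
(* The displacement is split as bt (xst - xh) + (1 - bt) (x - xh) + bt (z - xst): convexity handles
   the first two parts, and in the third [G] is replaced by [dd] up to noise. *)
have eG : ip G (xp - xh) = bt * ip G (xst - xh) + (1 - bt) * ip G (x - xh)
    + bt * (ip dd (z - xst) + ip (G - dd) (xb - xst) + ip (G - dd) (z - xb)).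
  have -> : ip dd (z - xst) + ip (G - dd) (xb - xst) + ip (G - dd) (z - xb) = ip G (z - xst).
    have e : ip (G - dd) (xb - xst) + ip (G - dd) (z - xb) = ip (G - dd) (z - xst).
      by rewrite -ipDr; congr ip; mxring.
    by rewrite -addrA e ipDl ipNl; ring.
  have -> : xp - xh = bt *: (xst - xh) + (1 - bt) *: (x - xh) + bt *: (z - xst).
    by rewrite /xp; mxring.
  by rewrite (ipDr (_ + _) (bt *: _)) (ipDr (bt *: _)) !ipZr; ring.
rewrite eG exh gnorm2Z in h1.
have pHz := pH (z - xb).
have q1 := ler_wpM2l b0 yg.
have q2 := ler_wpM2l b0 h3.
have b1' : 0 <= 1 - bt by rewrite subr_ge0.
have q3 := ler_wpM2l b1' h2.
have q4 := ler_wpM2l b0 h4.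
have q5 : bt * ((gam / 2 - nu * bt) * gnorm2 H (z - xb)) >= 0.
  by rewrite !mulr_ge0// subr_ge0.
have eg : 1 / (2 * (gam / 2)) = 1 / gam by field; rewrite gt_eqF.
rewrite eg in q1; rewrite /inner_gap.
move: cvx h1 q1 q2 q3 q4 q5; rewrite !(ipDl h).
move: (gnorm2 H _) (gnorm2 H _) (gnorm2 H _) (1 / gam * _) => *.
lra.
Qed.

(** Multiplying by t(t+1)/2 makes the step telescope: (1 - bt) turns this weight into the previous
    one, (t-1)t/2, and bt gam/2 turns it into 1/eta, free of t. The noise then carries the factors t
    and t^2 eta/2. *)
Lemma inner_step (x xb z G dd : 'cV[R]_n) (t : nat) (eta nu : R) :
  let bt := beta_t R t in
  let gam := 2 / (t%:R * eta) in
  let xh := bt *: xb + (1 - bt) *: x in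
  let xp := bt *: z + (1 - bt) *: x in
  (1 <= t)%N -> 0 < eta -> 0 < nu -> eta <= 1 / (2 * nu) ->
  f xp <= f xh + ip G (xp - xh) + nu / 2 * gnorm2 H (xp - xh) ->
  f xh + ip G (x - xh) <= f x ->
  f xh + ip G (xst - xh) <= f xst ->
  0 <= ip (dd + h + gam *: (H *m (z - xb)) + M *m (z - xk)) (xst - z) ->
  (t * t.+1)%:R / 2 * inner_gap xp + 1 / eta * gnorm2 H (z - xst) <=
  (t.-1 * t)%:R / 2 * inner_gap x + 1 / eta * gnorm2 H (xb - xst)
   + (t%:R * ip (G - dd) (xb - xst) + t%:R ^+ 2 * eta / 2 * gnorm2 (invmx H) (G - dd)).
Proof.
move=> bt gam xh xp t1 e0 n0 en h1 h2 h3 h4.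
have t0 : 0 < t%:R :> R by rewrite ltr0n.
have t0' : 0 < t%:R + 1 :> R by rewrite ltr_wpDr.
have bE : bt = 2 / (t%:R + 1) by [].
have g0 : 0 < gam by rewrite divr_gt0// mulr_gt0.
have b01 : 0 <= bt <= 1.
  rewrite bE divr_ge0 ?(ltW t0')//= ler_pdivrMr// mul1r.
  by rewrite (_ : 2 = 1 + 1)// lerD2r ler1n.
(* The claim amounts to 2 nu eta t <= t + 1; this is where the bound on eta by 1/(2 nu) enters. *)
have nub : nu * bt <= gam / 2.
  rewrite bE /gam [leRHS](_ : _ = 1 / (t%:R * eta)); last by field; rewrite !gt_eqF.
  rewrite ler_pdivlMr ?mulr_gt0//.
  rewrite [leLHS](_ : _ = (nu * eta * 2 * t%:R) / (t%:R + 1)); last by field; rewrite gt_eqF.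
  rewrite ler_pdivrMr// mul1r (@le_trans _ _ t%:R) ?lerDl//.
  rewrite ler_piMl ?(ltW t0)//; move: en; rewrite ler_pdivlMr ?mulr_gt0//; lra.
have := inner_step_convex b01 g0 nub h1 h2 h3 h4.
have tt0 : 0 <= t%:R * (t%:R + 1) / 2 :> R by rewrite divr_ge0// mulr_ge0// ltW.
move=> /(ler_wpM2l tt0).
have -> : (t * t.+1)%:R = t%:R * (t%:R + 1) :> R by rewrite natrM -[t.+1]addn1 natrD.
have -> : (t.-1 * t)%:R = (t%:R - 1) * t%:R :> R.
  by rewrite natrM -subn1 natrB.
rewrite -/xp => step.
rewrite -subr_ge0; move: step; rewrite -subr_ge0.
congr (0 <= _); rewrite bE /gam.
by field; rewrite !gt_eqF.
Qed.
End InnerStep.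

(** * Algebra of the two multiplier updates and of Delta *)

Section AdmmAlgebra.
Variables (R : realType) (n : nat).
Variables (beta tau s : R).
Hypotheses (b0 : 0 < beta) (D : in_Delta tau s).

(** The polynomial of Delta is minus (tau+s)^2 - (tau+s)(1+tau) + (1+tau)(tau-1). If tau <= -1,
    every term of the latter is nonnegative and the square is positive. The lemma justifies the
    divisions by 1 + tau. *)
Lemma in_Delta_gtN1 : 0 < 1 + tau.
Proof.
case: D => ts t1; rewrite -subr_ge0 => h; rewrite ltNge; apply/negP => tau1.
have : 0 < (tau + s) ^+ 2 - (tau + s) * (1 + tau) + (1 + tau) * (tau - 1).
  apply: ltr_wpDr; first by rewrite mulr_le0//; lra.
  by apply: ltr_wpDr; [rewrite -mulrN mulr_ge0 ?(ltW ts)//; lra | rewrite exprn_gt0].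
lra.
Qed.

(* The quadratic form written [||.||_G^2] in the analysis of symmetric ADMM,
   completed to a sum of two squares. *)
Definition admm_form (q p : 'cV[R]_n) : R :=
  1 / (beta * (tau + s)) * ip (p - (tau * beta) *: q) (p - (tau * beta) *: q)
  + beta * (1 - tau) * ip q q.

Lemma admm_form_ge0 q p : 0 <= admm_form q p.
Proof.
case: D => ts t1 _; rewrite addr_ge0// mulr_ge0 ?ip_ge0//.
  by rewrite divr_ge0// ltW// mulr_gt0.
by rewrite mulr_ge0 ?(ltW b0)// subr_ge0.
Qed.

(** In use [q] is B (y_k - yst), [p] is lam_k - l, [a] is the residual at (x_{k+1}, y_k) and [u] is
    B (y_{k+1} - y_k). The cross terms become a telescoping difference; the squares left over have
    factors 1 - tau >= 0 and 1 - s, and the latter may be negative. *)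
Lemma admm_form_step (p q a u : 'cV[R]_n) :
  let v := q + u in
  let p' := p - (tau * beta) *: a - (s * beta) *: (a + u) in
  - ip v ((tau * beta) *: a + beta *: u) + ip (p - beta *: a) (a + u) =
  1 / 2 * admm_form q p - 1 / 2 * admm_form v p'
   - beta / 2 * ((1 - tau) * ip a a + (1 - s) * ip (a + u) (a + u)).
Proof.
case: D => ts _ _ /=; rewrite /admm_form.
rewrite !(ipDl, ipDr, ipNl, ipNr, ipZl, ipZr).
rewrite (ipC q p) (ipC a p) (ipC u p) (ipC a q) (ipC u q) (ipC u a).
by field; rewrite !gt_eqF.
Qed.

(** Here [r] and [r0] are the new and the old residual. After multiplication by 1 + tau and use of
    the bound on [l], the right side minus the left is at least beta/2 times the squared norm of (1
    - tau) u + (s - 1) r0, plus beta/2 times the polynomial of Delta times the squared norm of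
    [r]. *)
Lemma admm_crossing (u r r0 : 'cV[R]_n) (l : R) :
  l <= beta * ip u ((1 - s) *: r0 - (1 + tau) *: r + tau *: u) ->
  beta / 2 * ((s - 1) ^+ 2 / (1 + tau)) * (ip r r - ip r0 r0) + (1 - tau) / (1 + tau) * l <=
  beta / 2 * ((1 - tau) * ip (r - u) (r - u) + (1 - s) * ip r r).
Proof.
have t1 := in_Delta_gtN1; case: D => ts tau1 dd.
rewrite !(ipDl, ipDr, ipNl, ipNr, ipZl, ipZr) (ipC r u) => hl.
have sq := ip_ge0 ((1 - tau) *: u + (s - 1) *: r0).
rewrite !(ipDl, ipDr, ipNl, ipNr, ipZl, ipZr) (ipC r0 u) in sq.
have rr := ip_ge0 r.
have tau1' : 0 <= 1 - tau by rewrite subr_ge0.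
have k1 := ler_wpM2l tau1' hl.
have k2 := mulr_ge0 dd rr.
have k2' := mulr_ge0 (ltW b0) k2.
have k3 := mulr_ge0 (ltW b0) sq.
rewrite -(ler_pM2r t1) -subr_ge0.
have -> : forall X Y : R, X * (1 + tau) -
    (beta / 2 * ((s - 1) ^+ 2 / (1 + tau)) * (ip r r - ip r0 r0)
     + (1 - tau) / (1 + tau) * l) * (1 + tau) =
    X * (1 + tau) - beta / 2 * (s - 1) ^+ 2 * (ip r r - ip r0 r0) - (1 - tau) * l.
  by move=> X _; field; rewrite gt_eqF.
move: k1 k2' k3; move: (ip u u) (ip u r) (ip u r0) (ip r r) (ip r0 r0) => uu ur ur0 rr' r00.
lra.
exact: 0.
Qed.
End AdmmAlgebra.

(** * Gradient inequalities for convex and for smooth functions *)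

Section Gradient.
Variables (R : realType) (n : nat).
Implicit Types (f : 'cV[R]_n -> R^o) (a b v x : 'cV[R]_n).

Lemma diff_gradE f x v : differentiable f x -> 'd f x v = ip (grad f x) v.
Proof.
move=> df; rewrite {1}(matrix_sum_delta v) linear_sum/= ipE; apply: eq_bigr => i _.
rewrite big_ord1 linearZ /= /grad mxE mulrC; congr (_ * _).
Qed.

Lemma is_derive_line f a v (t : R) : differentiable f (a + t *: v) ->
  is_derive t (1 : R) (fun t : R => f (a + t *: v) : R) (ip (grad f (a + t *: v)) v).
Proof.
move=> df.
have E : (fun h : R => h^-1 *: (f (a + (h *: (1 : R) + t) *: v) - f (a + t *: v))) =
         (fun h : R => h^-1 *: (f (h *: v + (a + t *: v)) - f (a + t *: v))).
  apply/funext => h; congr (_ *: (f _ - _)).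
  by rewrite [h *: 1]mulr1 scalerDl addrCA.
apply: DeriveDef.
  by rewrite /derivable /= E; exact: diff_derivable.
by rewrite /derive /= E -diff_gradE// -deriveE.
Qed.

Variable X : set 'cV[R]_n.
Hypothesis cX : convex_set X.

(** By convexity every difference quotient along b - a with step in (0, 1] is at most f b - f a.
    Limits are taken from the right, since the segment may leave [X] for negative steps. *)
Lemma convex_grad_le f a b : convex_on X f -> C1_near X f -> X a -> X b ->
  f a + ip (grad f a) (b - a) <= f b.
Proof.
move=> cf [U [_ XU df _]] Xa Xb.
have := is_derive_line (a := a) (v := b - a) (t := 0).
rewrite scale0r addr0 => /(_ _ (df _ (XU _ Xa))) [dv dE].
rewrite addrC -lerBrDr -dE.
have dvr := cvg_dnbhs_at_right dv.
rewrite /derive -(cvg_lim (@Rhausdorff R) dvr); apply: limr_le; first by apply/cvg_ex; eexists; exact: dvr.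
near=> h.
have h0 : 0 < h by near: h; exact: nbhs_right_gt.
have h1 : h <= 1 by near: h; exact: nbhs_right_le.
rewrite [h *: 1]mulr1 /= ?addr0 scale0r addr0 /GRing.scale/= ler_pdivrMl//.
have := cf b a h Xb Xa; rewrite (ltW h0) h1 => /(_ isT).
have -> : h *: b + (1 - h) *: a = a + h *: (b - a) by mxring.
lra.
Unshelve. all: by end_near.
Qed.

(** The function [psi], the restriction of [f] to the segment minus its quadratic upper model, has
    nonpositive derivative on [0, 1]. *)
Lemma lipschitz_grad_descent f (H : 'M[R]_n) (nu : R) a b :
  pd H -> 0 < nu -> C1_near X f ->
  (forall x1 x2, X x1 -> X x2 ->
     Num.sqrt (gnorm2 (invmx H) (grad f x1 - grad f x2))
       <= nu * Num.sqrt (gnorm2 H (x1 - x2))) ->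
  X a -> X b ->
  f b <= f a + ip (grad f a) (b - a) + nu / 2 * gnorm2 H (b - a).
Proof.
move=> pH nu0 [U [_ XU df _]] lip Xa Xb.
pose v := b - a; pose q := gnorm2 H v.
have Xt (t : R) : 0 <= t <= 1 -> X (a + t *: v) by move=> t01; exact: convex_set_segment.
pose psi (t : R) : R := f (a + t *: v) - (t * ip (grad f a) v + nu / 2 * q * t ^+ 2).
have dpsi (t : R) : 0 <= t <= 1 -> is_derive t (1 : R) psi
    (ip (grad f (a + t *: v)) v - (ip (grad f a) v + nu * q * t)).
  move=> t01; have := is_derive_line (df _ (XU _ (Xt _ t01))) => dl.
  apply: is_derive_eq.
  by rewrite scaler0 add0r; congr (_ - (_ + _)); [exact: mulr1 | rewrite /GRing.scale/=; lra].
have qE : 0 <= q by exact: (pd_psd pH).2.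
suff h : psi 1 <= psi 0.
  have e : a + v = b by rewrite /v; mxring.
  by move: h; rewrite /psi scale1r scale0r addr0 e /q; lra.
apply: (@ler0_derive1_le_cc R psi 0 1); rewrite ?in_itv/= ?lexx ?ler01//.
  - move=> t; rewrite in_itv/= => /andP[t0 t1].
    by have [] : is_derive t (1 : R) psi _ := dpsi t _; rewrite ?(ltW t0) ?(ltW t1).
  - move=> t; rewrite in_itv/= => /andP[t0 t1].
    have t01 : 0 <= t <= 1 by rewrite !ltW.
    rewrite derive1E; have [_ ->] := dpsi t t01.
    rewrite opprD addrA -ipNl -ipDl subr_le0.
    (* With the weight nu t, each half of Young's inequality is at most nu t q / 2, together the
       slope of the quadratic model. *)
    have nt : 0 < nu * t by rewrite mulr_gt0.
    apply: (le_trans (pd_young _ v pH nt)).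
    have e : (a + t *: v) - a = t *: v by mxring.
    have := lip (a + t *: v) a (Xt t t01) Xa; rewrite e gnorm2Z.
    move: (grad f (a + t *: v) - grad f a) => D0 hl.
    have [_ pHi] := psd_invmx pH.
    have {}hl : gnorm2 (invmx H) D0 <= (nu * t) ^+ 2 * q.
      rewrite -(sqr_sqrtr (pHi D0)) -(sqr_sqrtr qE) -exprMn.
      rewrite ler_sqr ?nnegrE ?sqrtr_ge0// ?mulr_ge0 ?sqrtr_ge0 ?(ltW nu0) ?(ltW t0)//.
      rewrite -mulrA -[X in X * Num.sqrt q](gtr0_norm t0) -sqrtr_sqr.
      by rewrite -sqrtrM ?sqr_ge0.
    have c0 : 0 <= 1 / (2 * (nu * t)) by rewrite divr_ge0// mulr_ge0// ltW.
    have := ler_wpM2l c0 hl.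
    have -> : 1 / (2 * (nu * t)) * ((nu * t) ^+ 2 * q) = nu * t / 2 * q.
      by field; rewrite !gt_eqF.
    by rewrite -/q; lra.
  - apply: derivable_within_continuous => t; rewrite in_itv/= => t01.
    by have [] := dpsi t t01.
Qed.

End Gradient.

(** * Measurability of continuous functions of random vectors *)

Lemma cvg_mxP (R : realType) m n (u : nat -> 'M[R]_(m, n)) (M : 'M[R]_(m, n)) :
  (forall i j, (fun k => u k i j) @ \oo --> M i j) -> u @ \oo --> M.
Proof.
move=> h A [Q MQ sQA].
have : \forall k \near \oo, forall i j, Q i j (u k i j).
  apply: filter_forall => i; apply: filter_forall => j.
  exact: (h i j _ (MQ i j)).
by apply: filterS => k hk; exact: sQA.
Qed.

Section GradientMeasurable.
Context d (T : measurableType d) (R : realType).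

Lemma measurable_fun_countable (C : countType) (z : T -> C) (h : C -> R) :
  (forall c, measurable (z @^-1` [set c])) -> measurable_fun setT (h \o z).
Proof.
move=> mz _ B mB; rewrite setTI.
rewrite (_ : _ @^-1` _ = \bigcup_n
   (if unpickle n is Some c then if h c \in B then z @^-1` [set c] else set0 else set0)).
  by apply: bigcupT_measurable => k; case: unpickle => // c; case: ifP.
apply/seteqP; split=> w /=.
  by move=> Bw; exists (pickle (z w)) => //; rewrite pickleK mem_set.
by move=> [k _]; case: unpickle => // c; case: ifP => // hc /= zw; move: hc; rewrite -zw => /set_mem.
Qed.

Lemma measurable_floor_eq (f : T -> R) (c : int) : measurable_fun setT f ->
  measurable [set w | Num.floor (f w) = c].
Proof.
move=> mf; have := mf measurableT _ (measurable_itv `[c%:~R, (c + 1)%:~R[%R).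
rewrite setTI; congr measurable; apply/seteqP; split=> w /=; rewrite in_itv/=.
  by move=> h; apply: floor_def.
by move=> <-; exact: floor_itv.
Qed.

(** Rounding each coordinate down to the grid of mesh 1/(k+1) gives a vector with countably many
    values, of which every function is measurable. Continuity of [G] at [v w] then passes to the
    limit. Rounded points may leave [U], which is harmless, as continuity is used only at [v w]. *)
Lemma measurable_continuous_comp n (U : set 'cV[R]_n) (G : 'cV[R]_n -> R) (v : T -> 'cV[R]_n) :
  open U -> (forall x, U x -> {for x, continuous G}) ->
  rvec v -> (forall w, U (v w)) -> measurable_fun setT (G \o v).
Proof.
move=> oU cG mv Uv.
pose z k w : {ffun 'I_n -> int} := [ffun i => Num.floor (v w i 0 * k.+1%:R)].
pose dec k (c : {ffun 'I_n -> int}) : 'cV[R]_n := \col_i ((c i)%:~R / k.+1%:R).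
apply: (@measurable_fun_cvg _ _ _ _ (fun k => (G \o dec k) \o z k)).
  move=> k; apply: measurable_fun_countable => c.
  rewrite (_ : _ @^-1` _ = \bigcap_(i in [set: 'I_n])
     [set w | Num.floor (v w i 0 * k.+1%:R) = c i]).
    apply: fin_bigcap_measurable => // i _; apply: measurable_floor_eq.
    by apply: measurable_funM => //; exact: mv.
  apply/seteqP; split=> w /=.
    by move=> <- i _ /=; rewrite ffunE.
  by move=> h; apply/ffunP => i; rewrite ffunE; exact: (h i).
move=> w _; apply: (cvg_comp (fun k => dec k (z k w)) G _ (cG _ (Uv w))).
apply: cvg_mxP => i j; rewrite ord1.
apply/cvgrPdist_le => e e0; near=> k.
rewrite /dec /z /= mxE ffunE.
have k0 : 0 < k.+1%:R :> R by [].
rewrite -[X in `|X - _|](mulfK (lt0r_neq0 k0)) -mulrBl normrM normfV (gtr0_norm k0).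
rewrite ler_pdivrMr// (@le_trans _ _ 1)//.
  have /andP[] := floor_itv (v w i 0 * k.+1%:R).
  rewrite intrD ger0_norm ?subr_ge0 ?floor_le// lerBlDl => _ /ltW; rewrite addrC.
  by rewrite addrC.
rewrite -ler_pdivrMl// mulr1.
near: k; near=> k; rewrite (@le_trans _ _ k%:R) ?ler_nat//.
by near: k; exact: nbhs_infty_ger.
Unshelve. all: by end_near.
Qed.
End GradientMeasurable.

(** * Monotonicity of the integral without measurability *)

Section NonMeasurableIntegral.
Context d (T : measurableType d) (R : realType).
Variable mu : {measure set T -> \bar R}.
Local Open Scope ereal_scope.

(* No measurability: the integral of a nonnegative function is a supremum over
   the simple functions below it.  Needed because a convex function need not be
   Borel on the relative boundary of its domain. *)
Lemma ge0_le_integral_nomeas (f1 f2 : T -> \bar R) : (forall x, 0 <= f1 x) ->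
  (forall x, f1 x <= f2 x) -> \int[mu]_x f1 x <= \int[mu]_x f2 x.
Proof.
move=> f10 f12; rewrite !ge0_integralTE//; last by move=> x; exact: le_trans (f12 x).
by apply: ereal_sup_le => _ [h /= hf <-]; exists h => //= x; exact: le_trans (f12 x).
Qed.

Lemma le_integral_nomeas (f1 f2 : T -> \bar R) : (forall x, f1 x <= f2 x) ->
  \int[mu]_x f1 x <= \int[mu]_x f2 x.
Proof.
move=> f12; rewrite integralE [leRHS]integralE leeB//.
- apply: ge0_le_integral_nomeas => x; first exact: funepos_ge0.
  by apply: (@funepos_le _ _ setT) => [y _|]; [exact: f12|rewrite inE].
- apply: ge0_le_integral_nomeas => x; first exact: funeneg_ge0.
  by apply: (@funeneg_le _ _ setT) => [y _|]; [exact: f12|rewrite inE].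
Qed.
End NonMeasurableIntegral.

(** * Integrable variables, second moments and bounds on means *)

Section Expectation.
Context d (T : measurableType d) (R : realType) (P : probability T R).
Implicit Types (X Y Z : T -> R) (a b c : R).

Definition intg X : Prop := P.-integrable setT (EFin \o X).

Lemma intg_meas X : intg X -> measurable_fun setT X.
Proof. by move=> /measurable_int /measurable_EFinP. Qed.

Lemma intgD X Y : intg X -> intg Y -> intg (fun w => X w + Y w).
Proof. by move=> iX iY; exact: integrableD iX iY. Qed.

Lemma intgZ c X : intg X -> intg (fun w => c * X w).
Proof. by move=> iX; exact: (integrableZl measurableT c iX). Qed.

Lemma intgN X : intg X -> intg (fun w => - X w).
Proof. by move=> /(intgZ (-1)); congr intg; apply/funext => w; rewrite mulN1r. Qed.

Lemma intg_cst c : intg (fun=> c).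
Proof. exact: finite_measure_integrable_cst. Qed.

Lemma intg_sum I (s : seq I) (F : I -> T -> R) :
  (forall i, intg (F i)) -> intg (fun w => \sum_(i <- s) F i w).
Proof.
move=> iF; elim: s => [|i s ih].
  by under eq_fun do rewrite big_nil; exact: intg_cst.
by under eq_fun do rewrite big_cons; exact: intgD.
Qed.

Lemma intg_le X Y : measurable_fun setT X -> intg Y -> (forall w, `|X w| <= Y w) -> intg X.
Proof.
move=> mX iY XY; apply: (le_integrable measurableT _ _ iY); first exact/measurable_EFinP.
by move=> w _ /=; rewrite lee_fin (le_trans (XY w))// ler_norm.
Qed.

(** Measurability is recorded separately: integrability of the square does not determine the sign of
    X measurably. *)
Definition sqint X : Prop := measurable_fun setT X /\ intg (fun w => X w ^+ 2).

Lemma sqint_cst c : sqint (fun=> c).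
Proof. by split=> //; exact: intg_cst. Qed.

Lemma sqint_le X Y : measurable_fun setT X -> intg Y -> (forall w, X w ^+ 2 <= Y w) -> sqint X.
Proof.
move=> mX iY XY; split=> //; apply: intg_le iY _; first exact: measurable_funX.
by move=> w; rewrite ger0_norm ?sqr_ge0.
Qed.

Lemma sqint_mul X Y : sqint X -> sqint Y -> intg (fun w => X w * Y w).
Proof.
move=> [mX iX] [mY iY]; apply: (intg_le _ (intgD iX iY)).
  exact: measurable_funM.
move=> w; rewrite ler_norml; have := sqr_ge0 (X w + Y w); have := sqr_ge0 (X w - Y w).
have := sqr_ge0 (X w); have := sqr_ge0 (Y w).
by rewrite sqrrB sqrrD => *; apply/andP; split; lra.
Qed.

Lemma sqintD X Y : sqint X -> sqint Y -> sqint (fun w => X w + Y w).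
Proof.
move=> [mX iX] [mY iY]; apply: (sqint_le _ (intgD (intgZ 2 iX) (intgZ 2 iY))).
  exact: measurable_funD.
by move=> w; have := sqr_ge0 (X w - Y w); rewrite sqrrB sqrrD; lra.
Qed.

Lemma sqintZ c X : sqint X -> sqint (fun w => c * X w).
Proof.
move=> [mX iX]; apply: (sqint_le _ (intgZ (c ^+ 2) iX)); first exact: measurable_funM.
by move=> w; rewrite exprMn.
Qed.

Lemma sqint_sum I (s : seq I) (F : I -> T -> R) :
  (forall i, sqint (F i)) -> sqint (fun w => \sum_(i <- s) F i w).
Proof.
move=> iF; elim: s => [|i s ih].
  by under eq_fun do rewrite big_nil; exact: sqint_cst.
by under eq_fun do rewrite big_cons; exact: sqintD.
Qed.

Definition vsqint n (v : T -> 'cV[R]_n) : Prop := forall i, sqint (fun w => v w i 0).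

Lemma vsqint_cst n (v : 'cV[R]_n) : vsqint (fun=> v).
Proof. by move=> i; exact: sqint_cst. Qed.

Lemma vsqintD n (u v : T -> 'cV[R]_n) : vsqint u -> vsqint v -> vsqint (fun w => u w + v w).
Proof. by move=> su sv i; under eq_fun do rewrite mxE; exact: sqintD. Qed.

Lemma vsqintZ n c (v : T -> 'cV[R]_n) : vsqint v -> vsqint (fun w => c *: v w).
Proof. by move=> sv i; under eq_fun do rewrite mxE; exact: sqintZ. Qed.

Lemma vsqintN n (v : T -> 'cV[R]_n) : vsqint v -> vsqint (fun w => - v w).
Proof. by move=> /(vsqintZ (-1)); congr vsqint; apply/funext => w; rewrite scaleN1r. Qed.

Lemma vsqintB n (u v : T -> 'cV[R]_n) : vsqint u -> vsqint v -> vsqint (fun w => u w - v w).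
Proof. by move=> su sv; apply: vsqintD => //; exact: vsqintN. Qed.

Lemma vsqintM n p (A : 'M[R]_(p, n)) (v : T -> 'cV[R]_n) :
  vsqint v -> vsqint (fun w => A *m v w).
Proof.
move=> sv i; under eq_fun do rewrite mxE.
by apply: sqint_sum => j; exact: sqintZ.
Qed.

Lemma vsqint_ip n (u v : T -> 'cV[R]_n) : vsqint u -> vsqint v -> intg (fun w => ip (u w) (v w)).
Proof.
move=> su sv; under eq_fun do rewrite ipE.
by apply: intg_sum => i; exact: sqint_mul.
Qed.

Lemma vsqint_gnorm2 n (G : 'M[R]_n) (v : T -> 'cV[R]_n) :
  vsqint v -> intg (fun w => gnorm2 G (v w)).
Proof.
move=> sv; under eq_fun do rewrite gnorm2E.
by apply: vsqint_ip => //; exact: vsqintM.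
Qed.

Lemma vsqint_le n (v : T -> 'cV[R]_n) Y : rvec v -> intg Y ->
  (forall w, ip (v w) (v w) <= Y w) -> vsqint v.
Proof.
move=> mv iY vY i; apply: (sqint_le _ iY); first exact: mv.
by move=> w; apply: le_trans (vY w); exact: coord_ip.
Qed.

Lemma rvec_ip n (u v : T -> 'cV[R]_n) : rvec u -> rvec v ->
  measurable_fun setT (fun w => ip (u w) (v w)).
Proof.
move=> mu mv; under eq_fun do rewrite ipE.
by apply: measurable_sum => i; apply: measurable_funM; [exact: mu|exact: mv].
Qed.

Lemma rvecM n p (A : 'M[R]_(p, n)) (v : T -> 'cV[R]_n) : rvec v -> rvec (fun w => A *m v w).
Proof.
move=> mv i; under eq_fun do rewrite mxE.
by apply: measurable_sum => j; apply: measurable_funM => //; exact: mv.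
Qed.

Lemma rvecD n (u v : T -> 'cV[R]_n) : rvec u -> rvec v -> rvec (fun w => u w + v w).
Proof. by move=> mu mv i; under eq_fun do rewrite mxE; apply: measurable_funD; [exact: mu|exact: mv]. Qed.

Lemma rvecZ n c (v : T -> 'cV[R]_n) : rvec v -> rvec (fun w => c *: v w).
Proof. by move=> mv i; under eq_fun do rewrite mxE; apply: measurable_funM => //; exact: mv. Qed.

Lemma rvec_cst n (v : 'cV[R]_n) : rvec (fun _ : T => v).
Proof. by move=> i; exact: measurable_cst. Qed.

Lemma rvec_gnorm2 n (G : 'M[R]_n) (v : T -> 'cV[R]_n) : rvec v ->
  measurable_fun setT (fun w => gnorm2 G (v w)).
Proof.
by move=> mv; under eq_fun do rewrite gnorm2E; apply: rvec_ip => //; exact: rvecM.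
Qed.

Lemma vsqint_pd n (G : 'M[R]_n) (v : T -> 'cV[R]_n) Y : pd G -> rvec v -> intg Y ->
  (forall w, gnorm2 G (v w) <= Y w) -> vsqint v.
Proof.
move=> pG mv iY vY i.
have iY' := intgZ (gnorm2 (invmx G) (delta_mx i 0) + 1) iY.
apply: (sqint_le _ iY'); first exact: mv.
move=> w; apply: (le_trans (pd_coord_le _ _ pG)); rewrite ler_wpM2l//.
by rewrite addr_ge0// (psd_invmx pG).2.
Qed.

Lemma intg_ge0 X c : measurable_fun setT X -> (forall w, 0 <= X w) ->
  (\int[P]_w (X w)%:E <= c%:E)%E -> intg X.
Proof.
move=> mX X0 Xc; apply/integrableP; split; first exact/measurable_EFinP.
under eq_integral do rewrite /= ger0_norm//.
by rewrite (le_lt_trans Xc)// ltry.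
Qed.

Lemma vsqint_vnorm n (v : T -> 'cV[R]_n) : rvec v ->
  (\int[P]_w (vnorm (v w) ^+ 2)%:E < +oo)%E -> vsqint v.
Proof.
move=> mv fin; apply: (@vsqint_le _ _ (fun w => ip (v w) (v w))) => //.
apply/integrableP; split; first exact/measurable_EFinP/rvec_ip.
under eq_integral do rewrite /= ger0_norm ?ip_ge0// -vnormE.
exact: fin.
Qed.

(** Integrability is bundled with the bound so that bounds on signed variables can be added. *)
Definition mean_le X c : Prop := intg X /\ (\int[P]_w (X w)%:E <= c%:E)%E.

Lemma mean_leD X Y a b : mean_le X a -> mean_le Y b -> mean_le (fun w => X w + Y w) (a + b).
Proof.
move=> [iX Xa] [iY Yb]; split; first exact: intgD.
under eq_integral do rewrite EFinD.
by rewrite (integralD measurableT iX iY) EFinD leeD.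
Qed.

Lemma mean_leZ c X a : 0 <= c -> mean_le X a -> mean_le (fun w => c * X w) (c * a).
Proof.
move=> c0 [iX Xa]; split; first exact: intgZ.
under eq_integral do rewrite EFinM.
by rewrite (integralZl measurableT iX) EFinM lee_wpmul2l.
Qed.

Lemma mean_le_sum (I : eqType) (s : seq I) (F : I -> T -> R) (a : I -> R) :
  (forall i, i \in s -> mean_le (F i) (a i)) ->
  mean_le (fun w => \sum_(i <- s) F i w) (\sum_(i <- s) a i).
Proof.
elim: s => [|i s ih] iF.
  under eq_fun do rewrite big_nil; rewrite big_nil; split; first exact: intg_cst.
  by rewrite integral0_eq.
under eq_fun do rewrite big_cons; rewrite big_cons; apply: mean_leD.
  by apply: iF; rewrite mem_head.
by apply: ih => j js; apply: iF; rewrite in_cons js orbT.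
Qed.

Lemma intg_mean_le X : intg X -> exists c, mean_le X c.
Proof.
move=> iX; exists (fine (\int[P]_w (X w)%:E)%E); split=> //.
by rewrite fineK//; exact: integrable_fin_num.
Qed.

Lemma mean_le_trans X a b : a <= b -> mean_le X a -> mean_le X b.
Proof. by move=> ab [iX Xa]; split=> //; rewrite (le_trans Xa)// lee_fin. Qed.

Lemma integral_le_mean (f : T -> R) X c : (forall w, f w <= X w) ->
  mean_le X c -> (\int[P]_w (f w)%:E <= c%:E)%E.
Proof. by move=> fX [_]; apply: le_trans; apply: le_integral_nomeas => w; rewrite lee_fin. Qed.

(** Monotonicity places the integral of [f] between those of the integrable m - X and m + X. In use
    [f] is the objective at the averaged point, which may fail to be measurable. *)
Lemma integral_near_cst (f : T -> \bar R) X (m c : R) :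
  (forall w, (m - X w)%:E <= f w <= (m + X w)%:E)%E -> mean_le X c ->
  (`| \int[P]_w f w - m%:E | <= c%:E)%E.
Proof.
move=> fX [iX Xc].
have im := intg_cst m.
have [r rE] : exists r, (\int[P]_w (X w)%:E = r%:E)%E.
  by exists (fine (\int[P]_w (X w)%:E)%E); rewrite fineK//; exact: integrable_fin_num.
have Ic : (\int[P]_w m%:E = m%:E)%E by rewrite integral_cst//= probability_setT mule1.
have lo : ((m - r)%:E <= \int[P]_w f w)%E.
  rewrite (_ : (m - r)%:E = \int[P]_w (m - X w)%:E)%E; last first.
    under eq_integral do rewrite EFinB.
    by rewrite (integralB measurableT im iX) [X in (X - _)%E]Ic [X in (_ - X)%E]rE EFinB.
  by apply: le_integral_nomeas => w; have /andP[] := fX w.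
have hi : (\int[P]_w f w <= (m + r)%:E)%E.
  rewrite (_ : (m + r)%:E = \int[P]_w (m + X w)%:E)%E; last first.
    under eq_integral do rewrite EFinD.
    by rewrite (integralD measurableT im iX) [X in (X + _)%E]Ic [X in (_ + X)%E]rE EFinD.
  by apply: le_integral_nomeas => w; have /andP[] := fX w.
move: lo hi Xc; rewrite rE.
case: (\int[P]_w f w)%E => [q| |]//; rewrite !lee_fin => lo hi Xc.
by rewrite ler_distl; apply/andP; split; lra.
Qed.

(** * Orthogonality to a sub-sigma-algebra *)

Section Orthogonality.
Variables (G : set (set T)) (D : T -> R).
Hypothesis Gm : forall E, <<s G >> E -> measurable E.
Hypothesis iD : intg D.
Hypothesis D0 : forall E, <<s G >> E -> (\int[P]_(w in E) (D w)%:E = 0)%E.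

(** The same sample space with the smaller sigma-algebra: measurability with respect to the past
    becomes ordinary measurability on [T']. *)
Let T' : measurableType _ := g_sigma_algebraType G.

Lemma measurable_g_sigma (Z : T -> R) : measurable_fun [set: T'] (Z : T' -> R) ->
  measurable_fun setT Z.
Proof.
by move=> mZ _ B mB; have := mZ measurableT B mB; rewrite !setTI => /Gm.
Qed.

Import HBNNSimple.

Lemma integral_mul_nnsfun0 (h : {nnsfun T' >-> R}) :
  (\int[P]_w (D w * h w)%:E = 0)%E.
Proof.
pose E (r : R) : set T := h @^-1` [set r].
have mE r : <<s G >> (E r).
  by have := @measurable_funPTI _ _ T' _ h _ (measurable_set1 r).
have DE r w : D w * \1_(E r) w = ((D \_ (E r)) w).
  by rewrite patchE indicE; case: ifPn => _; rewrite ?mulr1 ?mulr0.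
have iE r : intg (fun w => D w * \1_(E r) w).
  apply: (le_integrable measurableT _ _ iD).
    apply/measurable_EFinP; apply: measurable_funM; first exact: intg_meas.
    by apply: measurable_indic; exact: Gm.
  move=> w _; rewrite /= lee_fin indicE; case: (_ \in _); rewrite ?mulr1// mulr0 normr0.
  exact: normr_ge0.
have zE r : (\int[P]_w (D w * \1_(E r) w)%:E = 0)%E.
  rewrite -(D0 (mE r)) [RHS]integral_mkcond; apply: eq_integral => w _.
  by rewrite DE !patchE; case: ifP.
have [k [c hE]] : exists k (c : 'I_k -> R), forall w, h w = \sum_i c i * \1_(E (c i)) w.
  by eexists; eexists => w; exact: (fimfunEord h w).
under eq_integral => w _ do rewrite hE mulr_sumr -sumEFin.
rewrite (@integral_sum _ _ _ P setT measurableT _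
  (fun i w => (D w * (c i * \1_(E (c i)) w))%:E)).
  rewrite big1// => i _.
  under eq_integral => w _ do rewrite mulrCA EFinM.
  by rewrite (integralZl measurableT (iE _)) zE mule0.
move=> i; have := intgZ (c i) (iE (c i)).
by congr integrable; apply/funext => w; rewrite /= mulrCA.
Qed.

(** Simple functions increase to [Z]; since they stay below it, |D Z| dominates all the products,
    and dominated convergence applies although [D] has no sign. *)
Lemma integral_mul_ge0_eq0 (Z : T -> R) : measurable_fun [set: T'] (Z : T' -> R) ->
  (forall w, 0 <= Z w) -> intg (fun w => D w * Z w) -> (\int[P]_w (D w * Z w)%:E = 0)%E.
Proof.
move=> mZ Z0 iDZ.
have mZE : measurable_fun [set: T'] (EFin \o Z : T' -> \bar R) by exact/measurable_EFinP.
pose h := nnsfun_approx measurableT mZE.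
have hZ w : (fun k => h k w) @ \oo --> Z w.
  by have /fine_cvg := @cvg_nnsfun_approx _ _ _ _ measurableT _ mZE (fun x _ => Z0 x) w I.
have hle k w : h k w <= Z w.
  have : {homo (fun k => h k w) : m n / (m <= n)%N >-> m <= n}.
    by move=> m n mn; have /lefP := nd_nnsfun_approx measurableT mZE mn; exact.
  move=> hnd; rewrite -(cvg_lim (@Rhausdorff R) (hZ w)).
  apply: nondecreasing_cvgn_le => //; by apply/cvg_ex; eexists; exact: hZ.
have := @dominated_cvg _ _ _ P setT measurableT (fun k w => (D w * h k w)%:E)
  (fun w => (D w * Z w)%:E) (fun w => `|D w * Z w|%:E).
move=> H.
have : (fun k => \int[P]_w (D w * h k w)%:E)%E @ \oo --> (\int[P]_w (D w * Z w)%:E)%E.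
  apply: H => //.
  - move=> k; apply/measurable_EFinP; apply: measurable_funM; first exact: intg_meas.
    exact: measurable_g_sigma.
  - by move=> w _; apply: cvg_EFin; [exact: nearW|apply: cvgMl_tmp; exact: hZ].
  - exact: integrable_norm iDZ.
  - move=> k w _ /=; rewrite lee_fin !normrM ler_wpM2l// (ger0_norm (Z0 w)).
    by rewrite ger0_norm ?hle//; exact: fun_ge0.
under eq_fun do rewrite integral_mul_nnsfun0.
by move=> /(cvg_lim (@ereal_hausdorff R)) <-; rewrite lim_cst//; exact: ereal_hausdorff.
Qed.

Lemma integral_mul_eq0 (Z : T -> R) : measurable_fun [set: T'] (Z : T' -> R) ->
  intg (fun w => D w * Z w) -> (\int[P]_w (D w * Z w)%:E = 0)%E.
Proof.
move=> mZ iDZ.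
pose Zp w := Num.max (Z w) 0; pose Zn w := Num.max (- Z w) 0.
have ZE w : D w * Z w = D w * Zp w - D w * Zn w.
  rewrite /Zp /Zn -mulrBr; congr (_ * _).
  by case: (leP (Z w) 0) => ?; case: (leP (- Z w) 0) => ?; lra.
have mDZ (Y : T -> R) : measurable_fun [set: T'] (Y : T' -> R) -> (forall w, `|Y w| <= `|Z w|) ->
    intg (fun w => D w * Y w).
  move=> mY YZ; apply: (le_integrable measurableT _ _ iDZ).
    apply/measurable_EFinP; apply: measurable_funM; first exact: intg_meas.
    exact: measurable_g_sigma.
  by move=> w _; rewrite /= lee_fin !normrM ler_wpM2l.
have mp : measurable_fun [set: T'] (Zp : T' -> R) by apply: measurable_maxr.
have mn : measurable_fun [set: T'] (Zn : T' -> R).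
  by apply: measurable_maxr => //; exact: measurableT_comp.
have ip : intg (fun w => D w * Zp w).
  apply: mDZ => // w; rewrite /Zp; case: (leP (Z w) 0) => h; by rewrite ?normr0.
have in_ : intg (fun w => D w * Zn w).
  apply: mDZ => // w; rewrite /Zn; case: (leP (- Z w) 0) => h; by rewrite ?normr0 ?normrN.
under eq_integral do rewrite ZE EFinB.
rewrite (integralB measurableT ip in_).
by rewrite !integral_mul_ge0_eq0 ?sube0// => w; rewrite /Zp /Zn le_max lexx orbT.
Qed.
End Orthogonality.

End Expectation.

(** * Step sizes and the sums behind the rate *)

Lemma iota1S n : iota 1 n.+1 = iota 1 n ++ [:: n.+1].
Proof. by have := iotaD 1 n 1; rewrite addn1 add1n. Qed.

Section StepSizes.
Variables (R : realType) (c1 c2 c3 rho : R) (m : nat).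
Hypotheses (c1_gt0 : 0 < c1) (c2_gt0 : 0 < c2) (c3_gt0 : 0 < c3).
Hypotheses (rho_ge1 : 1 <= rho) (m_gt0 : (1 <= m)%N).
Local Notation mk := (mk c3 rho m).
Local Notation etak := (etak c1 c2 c3 rho m).

Lemma mk_gt0 k : (0 < mk k)%N.
Proof. by rewrite /Defs.mk leq_max m_gt0 orbT. Qed.

Lemma mk_le k : (mk k <= mk k.+1)%N.
Proof.
rewrite /Defs.mk geq_max leq_maxr andbT leq_max; apply/orP; left.
have p0 j : 0 <= Num.ceil (c3 * (j%:R `^ rho)).
  by rewrite -(@ceil0 R) le_ceil// mulr_ge0 ?powR_ge0// ltW.
rewrite -lez_nat !gez0_abs//; apply: le_ceil; rewrite ler_wpM2l ?(ltW c3_gt0)//.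
by apply: ge0_ler_powR; rewrite ?nnegrE ?ler_nat// (le_trans ler01).
Qed.

Lemma mk_ge k : c3 * (k%:R `^ rho) <= (mk k)%:R.
Proof.
rewrite (@le_trans _ _ (`|Num.ceil (c3 * (k%:R `^ rho))|%N)%:R)//; last first.
  by rewrite ler_nat leq_maxl.
have p0 : 0 <= Num.ceil (c3 * (k%:R `^ rho)).
  by rewrite -(@ceil0 R) le_ceil// mulr_ge0 ?powR_ge0// ltW.
by rewrite natr_absz ger0_norm// ceil_ge.
Qed.

(** The coefficient t(t+1)/2 of the inner gap at the end t = m_k of the inner loop. *)
Definition weight k : R := (mk k * (mk k).+1)%:R / 2.

Lemma weight_gt0 k : 0 < weight k.
Proof. by rewrite divr_gt0// ltr0n muln_gt0 mk_gt0. Qed.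

Lemma etak_gt0 k : 0 < etak k.
Proof.
by rewrite /Defs.etak lt_min c2_gt0 andbT divr_gt0// mulr_gt0// ltr0n ?mk_gt0.
Qed.

(** The rule for eta_k cancels m_k (m_k + 1) in the first argument, and the second grows with m_k,
    so the product is nondecreasing in k. *)
Lemma etak_weight k : etak k * weight k = Num.min (c1 / 2) (c2 * weight k).
Proof.
rewrite /Defs.etak minr_pMl ?(ltW (weight_gt0 k))//; congr Num.min.
rewrite /weight natrM; field.
by rewrite !(pnatr_eq0, lt0r_neq0)// ?ltr0n ?mk_gt0// -lt0n mk_gt0.
Qed.

(** This is the coefficient of the [H]-distance in the potential; it must not grow, or the outer
    steps would not telescope. *)
Lemma inv_etak_weight_le k :
  1 / (etak k.+1 * weight k.+1) <= 1 / (etak k * weight k).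
Proof.
have e0 j : 0 < etak j * weight j by rewrite mulr_gt0 ?etak_gt0 ?weight_gt0.
rewrite !div1r lef_pV2 ?posrE//.
rewrite !etak_weight le_min ge_min lexx /= ge_min; apply/orP; right.
rewrite ler_wpM2l ?(ltW c2_gt0)// /weight ler_pM2r// ler_nat leq_mul ?ltnS ?mk_le//.
Qed.

(* sum_{i <= n} i^2 = n(n+1)(2n+1)/6 <= (n+1)^3/3, against eta_k <= c_1/(n(n+1)) *)
Lemma etak_sum_sqr_le k :
  1 / weight k * (\sum_(i <- iota 1 (mk k)) i%:R ^+ 2 * etak k / 2) <= c1 * (1 / (mk k)%:R).
Proof.
have sqs n : \sum_(i <- iota 1 n) i%:R ^+ 2 <= n%:R * (n * n.+1)%:R / 2 :> R.
  elim: n => [|n ih]; first by rewrite big_nil !mul0r.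
  rewrite iota1S big_cat/= big_seq1.
  apply: (le_trans (lerD ih (lexx _))).
  have e1 : n.+1%:R = n%:R + 1 :> R by rewrite -addn1 natrD.
  have e2 : n.+2%:R = n%:R + 2 :> R by rewrite -addn2 natrD.
  rewrite !natrM e1 e2.
  have : 0 <= n%:R :> R by []; move: (n%:R : R) => z z0; nra.
rewrite -mulr_suml -mulr_suml.
have w0 := weight_gt0 k; have m0 : 0 < (mk k)%:R :> R by rewrite ltr0n mk_gt0.
have e1 : etak k <= c1 / ((mk k)%:R * (mk k).+1%:R) by rewrite /Defs.etak ge_min lexx.
have e2 := ltW (etak_gt0 k).
have := sqs (mk k); rewrite -mulrA -/(weight k) => h.
apply: (@le_trans _ _ (1 / weight k * ((mk k)%:R * weight k * etak k / 2))).
  rewrite ler_wpM2l ?divr_ge0 ?(ltW w0)// ler_wpM2r// ler_wpM2r//.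
have -> : 1 / weight k * ((mk k)%:R * weight k * etak k / 2) = (mk k)%:R / 2 * etak k.
  by field; rewrite gt_eqF.
apply: (le_trans (ler_wpM2l _ e1)); first by rewrite divr_ge0// ltW.
have -> : (mk k)%:R / 2 * (c1 / ((mk k)%:R * (mk k).+1%:R)) = c1 * (1 / (2 * (mk k).+1%:R)).
  by field; rewrite !gt_eqF.
rewrite ler_wpM2l ?(ltW c1_gt0)// !div1r lef_pV2 ?posrE ?mulr_gt0//.
by rewrite -natrM ler_nat mul2n -addnn (leq_trans (leqnSn _))// leq_addr.
Qed.

(** This is ln (1 + z) <= z at z = -1/(k+1). *)
Lemma invS_le_lnB (k : nat) : (0 < k)%N -> k.+1%:R^-1 <= ln k.+1%:R - ln k%:R :> R.
Proof.
move=> k0; have kp : 0 < k%:R :> R by rewrite ltr0n.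
have kp1 : 0 < k.+1%:R :> R by rewrite ltr0n.
have e : 1 + - k.+1%:R^-1 = k%:R / k.+1%:R :> R.
  by rewrite -[k.+1]addn1 natrD; field; rewrite gt_eqF// -[1]/(1%:R) -natrD addn1.
have lt : -1 < - k.+1%:R^-1 :> R by rewrite ltrN2 invf_lt1// ltr1n ltnS.
have := le_ln1Dx lt; rewrite e lnM ?posrE ?invr_gt0// lnV ?posrE//.
by move: (ln k.+1%:R) (ln k%:R) (k.+1%:R^-1) => p q r; lra.
Qed.

Lemma harmonic_sum_le (n : nat) : (0 < n)%N ->
  \sum_(i <- iota 1 n) i%:R^-1 <= 1 + ln n%:R :> R.
Proof.
elim: n => // n ih _; have [->|n0] := posnP n; first by rewrite big_seq1 invr1 ln1 addr0.
rewrite iota1S big_cat/= big_seq1.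
have := ih n0; have := invS_le_lnB n0.
by move: (ln _) (ln _) (n.+1%:R^-1) (\sum_(i <- _) _) => p q r t; lra.
Qed.

(** A telescoping substitute for the comparison with an integral: with a = rho - 1, each term
    (k+1)^-rho is at most (k^-a - (k+1)^-a) / a. *)
Lemma powR_sum_le (n : nat) : 1 < rho ->
  \sum_(i <- iota 1 n) (i%:R `^ rho)^-1 <= 1 + (rho - 1)^-1 :> R.
Proof.
move=> r1; pose a := rho - 1; have a0 : 0 < a by rewrite subr_gt0.
have step (k : nat) : (0 < k)%N ->
    (k.+1%:R `^ rho)^-1 <= a^-1 * ((k%:R `^ a)^-1 - (k.+1%:R `^ a)^-1) :> R.
  move=> k0; have kp : 0 < k%:R :> R by rewrite ltr0n.
  have kp1 : 0 < k.+1%:R :> R by rewrite ltr0n.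
  rewrite ler_pdivlMl//.
  have -> : (k.+1%:R `^ rho)^-1 = (k.+1%:R `^ a)^-1 * k.+1%:R^-1 :> R.
    rewrite -invfM; congr (_^-1).
    by rewrite -[X in _ * X]powRr1 ?(ltW kp1)// -powRD /a ?subrK// pnatr_eq0 implybT.
  (* Write k^-a as (k+1)^-a exp (a (ln (k+1) - ln k)) and use exp z >= 1 + z with the logarithmic
     bound. *)
  have key : (k.+1%:R `^ a)^-1 * (1 + a * k.+1%:R^-1) <= (k%:R `^ a)^-1 :> R.
    rewrite /powR !gt_eqF// -!expRN.
    have -> : - (a * ln k%:R) = - (a * ln k.+1%:R) + a * (ln k.+1%:R - ln k%:R) :> R by ring.
    rewrite expRD ler_wpM2l ?expR_ge0// (le_trans (expR_ge1Dx _))// ler_expR.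
    by rewrite ler_wpM2l ?(ltW a0)// invS_le_lnB.
  by rewrite lerBrDl; move: key; rewrite mulrDr mulr1 mulrCA.
suff: (0 < n)%N -> \sum_(i <- iota 1 n) (i%:R `^ rho)^-1 <= 1 + a^-1 * (1 - (n%:R `^ a)^-1) :> R.
  have [->|n0] := posnP n; first by move=> _; rewrite big_nil addr_ge0// invr_ge0 ltW.
  move=> /(_ isT) /le_trans; apply; rewrite lerD2l.
  by apply: ler_piMr; rewrite ?invr_ge0 ?(ltW a0)// gerBl invr_ge0 powR_ge0.
elim: n => // n ih _; have [->|n0] := posnP n.
  by rewrite big_seq1 !powR1 invr1 subrr mulr0 addr0.
rewrite iota1S big_cat/= big_seq1.
have := ih n0; have := step _ n0; rewrite !mulrBr.
move: (a^-1 * (n%:R `^ a)^-1) (a^-1 * (n.+1%:R `^ a)^-1) ((n.+1%:R `^ rho)^-1).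
by move: (\sum_(i <- _) _) => p q r t; lra.
Qed.

(** The factor [Erho rho n * n%:R] is 1 for rho > 1 and 1 + ln n for rho = 1, the growth of the
    partial sums of k^-rho, to which m_k >= c3 k^rho reduces the sum. *)
Lemma sum_inv_mk_le (kappa : nat) : (1 <= kappa)%N -> exists2 K : R, 0 < K &
  forall n, (1 <= n)%N ->
    \sum_(k <- iota kappa n) 1 / (mk k)%:R <= K * (Erho rho n * n%:R).
Proof.
move=> kap.
have mkV k : (1 <= k)%N -> 1 / (mk k)%:R <= c3^-1 * (k%:R `^ rho)^-1 :> R.
  move=> k1; rewrite -invfM div1r lef_pV2 ?posrE ?ltr0n ?mk_gt0 ?mk_ge//.
  by rewrite mulr_gt0// powR_gt0// ltr0n.
have c3' : 0 < c3^-1 by rewrite invr_gt0.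
(* shifting the window of indices down to 1, ..., n only increases the sum *)
have shift n : \sum_(k <- iota kappa n) 1 / (mk k)%:R <=
    c3^-1 * \sum_(k <- iota 1 n) (k%:R `^ rho)^-1 :> R.
  rewrite mulr_sumr -[kappa]addn0 iotaDl -[1%N]addn0 iotaDl !big_map.
  apply: ler_sum => k _; apply: (le_trans (mkV _ _)); first by rewrite addn_gt0 kap.
  rewrite ler_wpM2l ?(ltW c3')// lef_pV2 ?posrE ?powR_gt0 ?ltr0n ?addn_gt0 ?kap//.
  apply: ge0_ler_powR; rewrite ?nnegrE// ?(le_trans ler01)//.
  by rewrite ler_nat leq_add2r.
have [r1|r1] := ltP 1 rho.
  exists (c3^-1 * (1 + (rho - 1)^-1)).
    by rewrite mulr_gt0// addr_gt0// invr_gt0 subr_gt0.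
  move=> n n1; rewrite /Erho r1 mulVf ?mulr1 ?pnatr_eq0 -?lt0n//.
  by apply: (le_trans (shift n)); rewrite ler_wpM2l ?(ltW c3')// powR_sum_le.
exists c3^-1 => // n n1; rewrite /Erho ltNge r1 /= divfK ?pnatr_eq0 -?lt0n//.
apply: (le_trans (shift n)); rewrite ler_wpM2l ?(ltW c3')//.
have -> : rho = 1 by apply/eqP; rewrite eq_le r1.
by under eq_bigr do rewrite powRr1//; exact: harmonic_sum_le.
Qed.

(** Lets the contribution of the initial potential, of order 1/n, be absorbed into the rate. *)
Lemma Erho_ge (n : nat) : (1 <= n)%N -> 1 <= Erho rho n * n%:R.
Proof.
move=> n1; rewrite /Erho; case: ifP => _; first by rewrite mulVf ?pnatr_eq0 -?lt0n.
by rewrite divfK ?pnatr_eq0 -?lt0n// lerDl ln_ge0// ler1n.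
Qed.
End StepSizes.

(** * The finite-sum objective, and Jensen's inequality for averages *)

Section Average.
Variables (R : realType) (n N : nat) (X : set 'cV[R]_n) (fs : 'I_N -> 'cV[R]_n -> R).
Hypotheses (cX : convex_set X) (N_gt0 : (0 < N)%N).
Hypothesis hf : forall j, convex_on X (fs j) /\ C1_near X (fs j).

Let Ni_ge0 : 0 <= N%:R^-1 :> R. Proof. by rewrite invr_ge0. Qed.

Let avg_cst (c : R) : c = N%:R^-1 * \sum_(j < N) c.
Proof. by rewrite sumr_const card_ord -[c *+ N]mulr_natl mulKf// pnatr_eq0 -lt0n. Qed.

Lemma favg_grad x : X x -> grad (favg fs) x = N%:R^-1 *: \sum_(j < N) grad (fs j) x.
Proof.
move=> Xx.
have df j : differentiable (fs j : 'cV[R]_n -> R^o) x.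
  by have [_ [U [_ XU dU _]]] := hf j; exact: dU (XU _ Xx).
have dE I (s : seq I) (h : I -> 'cV[R]_n -> R^o) : (forall i, differentiable (h i) x) ->
    differentiable (fun z => \sum_(i <- s) h i z : R^o) x /\
    forall v, 'd (fun z => \sum_(i <- s) h i z : R^o) x v = \sum_(i <- s) 'd (h i) x v.
  move=> dh; elim: s => [|i s [ih1 ih2]].
    split=> [|v].
      by under eq_fun do rewrite big_nil; exact: differentiable_cst.
    rewrite big_nil (_ : (fun _ => _) = cst 0) ?diff_cst//.
    by apply/funext => z; rewrite big_nil.
  have e : (fun z => \sum_(j <- i :: s) h j z : R^o) = h i + (fun z => \sum_(j <- s) h j z : R^o).
    by apply/funext => z; rewrite big_cons.
  split=> [|v]; first by rewrite e; exact: differentiableD.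
  rewrite e (diffD (dh i) ih1) big_cons -ih2; exact: erefl.
have [d1 d2] := dE _ (index_enum 'I_N) (fun j => fs j : 'cV[R]_n -> R^o) df.
apply/matrixP => i k; rewrite !mxE summxE.
have -> : favg fs = (N%:R^-1 : R) *: (fun z => \sum_(j < N) fs j z : R^o) by exact: erefl.
rewrite (diffZ _ d1) /= d2; congr (_ * _); apply: eq_bigr => j _.
by rewrite [RHS]mxE; exact: erefl.
Qed.

Lemma favg_convex a b t : X a -> X b -> 0 <= t <= 1 ->
  favg fs (t *: a + (1 - t) *: b) <= t * favg fs a + (1 - t) * favg fs b.
Proof.
move=> Xa Xb t01; rewrite /favg !(mulrCA _ N%:R^-1) -mulrDr ler_wpM2l// !mulr_sumr -big_split/=.
by apply: ler_sum => j _; apply: (hf j).1.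
Qed.

Lemma favg_grad_le a b : X a -> X b ->
  favg fs a + ip (grad (favg fs) a) (b - a) <= favg fs b.
Proof.
move=> Xa Xb; rewrite favg_grad// ipZl ip_suml /favg -mulrDr ler_wpM2l// -big_split/=.
by apply: ler_sum => j _; have [h1 h2] := hf j; exact: (convex_grad_le h1 h2 Xa Xb).
Qed.

Variables (H : 'M[R]_n) (nu : R).
Hypotheses (pdH : pd H) (nu_gt0 : 0 < nu).
Hypothesis lip : forall j x1 x2, X x1 -> X x2 ->
     Num.sqrt (gnorm2 (invmx H) (grad (fs j) x1 - grad (fs j) x2))
       <= nu * Num.sqrt (gnorm2 H (x1 - x2)).

Lemma favg_descent a b : X a -> X b ->
  favg fs b <= favg fs a + ip (grad (favg fs) a) (b - a) + nu / 2 * gnorm2 H (b - a).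
Proof.
move=> Xa Xb; rewrite favg_grad// ipZl ip_suml /favg [X in _ + X]avg_cst -!mulrDr ler_wpM2l//.
rewrite -!big_split/=.
apply: ler_sum => j _; have [_ h2] := hf j.
exact: (lipschitz_grad_descent cX pdH nu_gt0 h2 (@lip j) Xa Xb).
Qed.
End Average.

(** Induction, the newest point entering with weight 1/(k+1). Closure of [C] and convexity of [h]
    are bundled so that [C] can be the effective domain of [g] in [Y], on which [fine \o g] is
    convex. *)
Lemma jensen_average (R : realType) n (C : set 'cV[R]_n) (h : 'cV[R]_n -> R) (u : nat -> 'cV[R]_n)
    (k0 k : nat) :
  (forall a b t, C a -> C b -> 0 <= t <= 1 -> C (t *: a + (1 - t) *: b) /\
     h (t *: a + (1 - t) *: b) <= t * h a + (1 - t) * h b) ->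
  (forall i, (k0 <= i)%N -> C (u i)) -> (1 <= k)%N ->
  C (k%:R^-1 *: \sum_(i <- iota k0 k) u i) /\
  h (k%:R^-1 *: \sum_(i <- iota k0 k) u i) <= k%:R^-1 * \sum_(i <- iota k0 k) h (u i).
Proof.
move=> hC hu; elim: k => // k ih _; have [->|k_gt0] := posnP k.
  by rewrite /= !big_seq1 invr1 scale1r mul1r; split=> //; exact: hu.
have {ih} [ih1 ih2] := ih k_gt0.
have kp : 0 < k%:R :> R by rewrite ltr0n.
have e : k.+1%:R = k%:R + 1 :> R by rewrite -addn1 natrD.
have iotaE : iota k0 k.+1 = iota k0 k ++ [:: (k0 + k)%N] by have := iotaD k0 k 1; rewrite addn1.
have t01 : 0 <= (k.+1%:R^-1 : R) <= 1 by rewrite invr_ge0 ler0n invf_le1// ler1n.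
have Cu := hu _ (leq_addr k k0).
have [h1 h2] := hC _ _ _ Cu ih1 t01.
have e1 : 1 - k.+1%:R^-1 = k.+1%:R^-1 * k%:R :> R by rewrite e; field; rewrite gt_eqF// ltr_wpDl.
rewrite iotaE !big_cat !big_seq1/=.
have -> : k.+1%:R^-1 *: (\sum_(i <- iota k0 k) u i + u (k0 + k)%N) =
    k.+1%:R^-1 *: u (k0 + k)%N + (1 - k.+1%:R^-1) *: (k%:R^-1 *: \sum_(i <- iota k0 k) u i).
  by rewrite e1 scalerA mulfK ?gt_eqF// addrC scalerDr.
split=> //; apply: (le_trans h2); rewrite mulrDr addrC lerD2r.
have h3 : 0 <= 1 - k.+1%:R^-1 :> R by rewrite subr_ge0; case/andP: t01.
apply: (le_trans (ler_wpM2l h3 ih2)); rewrite e1 -mulrA mulVKf ?gt_eqF//.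
Qed.

(** * Consequences of the saddle point property *)

Section Saddle.
Variables (R : realType) (n1 n2 n N : nat).
Variables (X : set 'cV[R]_n1) (Y : set 'cV[R]_n2).
Variables (A : 'M[R]_(n, n1)) (B : 'M[R]_(n, n2)) (b : 'cV[R]_n).
Variables (fs : 'I_N -> 'cV[R]_n1 -> R) (g : 'cV[R]_n2 -> \bar R).
Variables (xst : 'cV[R]_n1) (yst : 'cV[R]_n2) (lst : 'cV[R]_n).
Hypotheses (gY : proper_convex_on Y g) (sp : saddle_point A B b fs g X Y xst yst lst).

Lemma saddle_fin : g yst \is a fin_num.
Proof.
have [gN [y1 [Yy1 gy1]] _] := gY; have [Xs Ys h] := sp.
rewrite fin_numE gN//=; have [_] := h xst y1 0 Xs Yy1.
by apply: contraTneq => gE; rewrite /Lag /Fobj gE -(fineK gy1).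
Qed.

Lemma saddle_resid : resid A B b xst yst = 0.
Proof.
have [Xs Ys h] := sp.
(* Testing the multiplier lst - r, with r the residual, leaves |r|^2 <= 0. *)
have [+ _] := h xst yst (lst - resid A B b xst yst) Xs Ys.
rewrite /Lag /Fobj -(fineK saddle_fin) -!EFinD !lee_fin ipDl ipNl => hr.
apply/eqP; rewrite -ip_eq0 eq_le ip_ge0 andbT; lra.
Qed.

Lemma saddle_ge (x : 'cV[R]_n1) (y : 'cV[R]_n2) : X x -> Y y -> g y \is a fin_num ->
  0 <= favg fs x + fine (g y) - (favg fs xst + fine (g yst)) - ip lst (resid A B b x y).
Proof.
move=> Xx Yy gy; have [_ _ /(_ x y 0 Xx Yy) [_]] := sp.
rewrite /Lag /Fobj saddle_resid -(fineK saddle_fin) -(fineK gy) -!EFinD !lee_fin.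
by rewrite ipC ip0l; lra.
Qed.
End Saddle.

(** * The inner loop along a run *)

Section Run.
Variables (R : realType) (n1 n2 n N : nat).
Variables (X : set 'cV[R]_n1) (Y : set 'cV[R]_n2).
Variables (A : 'M[R]_(n, n1)) (B : 'M[R]_(n, n2)) (b : 'cV[R]_n).
Variables (fs : 'I_N -> 'cV[R]_n1 -> R) (g : 'cV[R]_n2 -> \bar R).
Variables (H : 'M[R]_n1) (nu : R) (beta : R) (L : 'M[R]_n2) (tau s : R).
Variables (c1 c2 c3 rho : R) (m kappa : nat) (M : nat -> 'M[R]_n1).
Variables (d : measure_display) (T : measurableType d) (P : probability T R).
Variables (xi : nat -> nat -> T -> 'I_N) (e : nat -> nat -> T -> 'cV[R]_n1).
Variables (x xb : nat -> T -> 'cV[R]_n1) (y : nat -> T -> 'cV[R]_n2)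
  (lam : nat -> T -> 'cV[R]_n) (xs xbs : nat -> nat -> T -> 'cV[R]_n1).
Variables (x0 : 'cV[R]_n1) (y0 : 'cV[R]_n2) (lam0 : 'cV[R]_n).
Hypotheses (cX : convex_set X) (cY : convex_set Y) (gY : proper_convex_on Y g).
Hypotheses (N_gt0 : (0 < N)%N).
Hypothesis hf : forall j, convex_on X (fs j) /\ C1_near X (fs j).
Hypotheses (pdH : pd H) (nu_gt0 : 0 < nu).
Hypothesis lip : forall j x1 x2, X x1 -> X x2 ->
     Num.sqrt (gnorm2 (invmx H) (grad (fs j) x1 - grad (fs j) x2))
       <= nu * Num.sqrt (gnorm2 H (x1 - x2)).
Hypotheses (beta_gt0 : 0 < beta) (psdL : psd L) (Dts : in_Delta tau s).
Hypotheses (c1_gt0 : 0 < c1) (c3_gt0 : 0 < c3) (c2_gt0 : 0 < c2) (c2_le : c2 <= 1 / (2 * nu)).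
Hypotheses (rho_ge1 : 1 <= rho) (m_gt0 : (1 <= m)%N).
Hypothesis hM : forall k, sym_mx (M k) /\ psd (M k - beta *: (A^T *m A)).
Hypothesis run : sas_admm_run X Y A B b fs g H beta L tau s (mk c3 rho m)
  (etak c1 c2 c3 rho m) M xi e x xb y lam xs xbs x0 y0 lam0.

Local Notation mk := (mk c3 rho m).
Local Notation etak := (etak c1 c2 c3 rho m).
Local Notation weight := (weight c3 rho m).
Local Notation delta := (delta fs xi e xs xbs).
Local Notation xhat := (xhat xs xbs).
Local Notation hk := (hk A B b beta x y lam).
Local Notation lam_half := (lam_half A B b beta tau x y lam).
Local Notation resid := (resid A B b).

Lemma psd_M k : psd (M k).
Proof.
have [sM [_ pD]] := hM k; split=> // v.
have := pD v; rewrite gnorm2_sub gnorm2_scale gnorm2_mulmx subr_ge0; apply: le_trans.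
by rewrite mulr_ge0 ?ip_ge0// ltW.
Qed.

(** As beta_1 = 1, the iterate [xs k 2] equals the minimizer [xbs k 2]; the later ones are convex
    combinations. *)
Lemma inner_mem k t w : (1 <= t <= mk k)%N -> X (xs k t.+1 w) /\ X (xbs k t.+1 w).
Proof.
have [_ _ inner _ _] := run w; elim: t => // t ih /andP[_ tm].
have [[Xb _] ->] := inner k t.+1 tm; split=> //.
have [t0|t0] := posnP t.
  rewrite t0 in Xb *; have -> : beta_t R 1 = 1 by rewrite /beta_t -(natrD _ 1 1) divff ?pnatr_eq0.
  by rewrite subrr scale1r scale0r addr0.
have [|Xs _] := ih; first by rewrite t0 ltnW.
apply: convex_setP => //; rewrite /beta_t divr_ge0//= ler_pdivrMr ?mul1r; last by rewrite ltr_wpDl.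
by rewrite (_ : 2 = 1 + 1)// lerD2r ler1n.
Qed.

Lemma outer_mem k w : (1 <= k)%N -> X (x k w) /\ X (xb k w).
Proof.
case: k => // k _; have [_ _ _ /(_ k) [-> ->] _] := run w.
by apply: inner_mem; rewrite (mk_gt0 _ _ m_gt0) leqnn.
Qed.

Lemma inner_mem0 k t w : (1 <= k)%N -> (1 <= t <= (mk k).+1)%N -> X (xs k t w) /\ X (xbs k t w).
Proof.
move=> k1; case: t => // -[_|t /andP[_ tm]]; last exact: inner_mem.
by have [_ /(_ k) [-> ->] _ _ _] := run w; exact: outer_mem.
Qed.

Lemma xhat_mem k t w : (1 <= k)%N -> (1 <= t <= mk k)%N -> X (xhat k t w).
Proof.
move=> k1 /andP[t1 tm].
have tm' : (1 <= t <= (mk k).+1)%N by rewrite t1 leqW.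
have [Xs Xb] := inner_mem0 w k1 tm'.
apply: convex_setP => //; rewrite /beta_t divr_ge0//= ler_pdivrMr ?mul1r; last by rewrite ltr_wpDl.
by rewrite (_ : 2 = 1 + 1)// lerD2r ler1n.
Qed.

Lemma inner_optimality k t w z : (1 <= t <= mk k)%N -> X z ->
  0 <= ip (dir fs xi e xs xbs k t w + hk k w + gamma_t etak k t *: (H *m (xbs k t.+1 w - xbs k t w))
           + M k *m (xbs k t.+1 w - x k w)) (z - xbs k t.+1 w).
Proof.
move=> tm Xz; have [_ _ inner _ _] := run w; have [am _] := inner k t tm.
by apply: (prox_optimality cX _ _ am Xz); [case: pdH|case: (hM k)].
Qed.

Definition lam_tilde k w : 'cV[R]_n := lam k w - beta *: (A *m x k.+1 w + B *m y k w - b).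

Section Comparator.
Variable xst : 'cV[R]_n1.
Hypothesis Xst : X xst.

Definition noise_term k t w : R :=
  t%:R * ip (delta k t w) (xbs k t w - xst)
  + t%:R ^+ 2 * etak k / 2 * gnorm2 (invmx H) (delta k t w).

(** The coefficient of the gap vanishes at t = 0, so only the [H]-distance of [xb k] survives from
    the start of the loop. *)
Lemma inner_loop k w t : (1 <= k)%N -> (t <= mk k)%N ->
  (t * t.+1)%:R / 2 * inner_gap (M k) (favg fs) xst (x k w) (hk k w) (xs k t.+1 w)
    + 1 / etak k * gnorm2 H (xbs k t.+1 w - xst) <=
  1 / etak k * gnorm2 H (xb k w - xst) + \sum_(i <- iota 1 t) noise_term k i w.
Proof.
move=> k1; have [_ start inner _ _] := run w.
elim: t => [_|t ih tm].
  by rewrite !mul0r add0r big_nil addr0; have [_ ->] := start k.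
have [_ xsE] := inner k t.+1 tm.
have t1 : (1 <= t.+1)%N by [].
have [Xs Xb] : X (xs k t.+1 w) /\ X (xbs k t.+1 w) by apply: inner_mem0 => //; rewrite /= leqW.
have [Xs1 Xb1] : X (xs k t.+2 w) /\ X (xbs k t.+2 w) by apply: inner_mem0.
have Xh : X (xhat k t.+1 w) by apply: xhat_mem.
have eta_le : etak k <= 1 / (2 * nu).
  by apply: le_trans c2_le; rewrite /Defs.etak ge_min lexx orbT.
have := @inner_step R n1 H (M k) pdH (psd_M k) (favg fs) xst (x k w) (hk k w)
  (xs k t.+1 w) (xbs k t.+1 w) (xbs k t.+2 w) (grad (favg fs) (xhat k t.+1 w))
  (dir fs xi e xs xbs k t.+1 w) t.+1 (etak k) nu t1 (etak_gt0 c3 rho c1_gt0 c2_gt0 m_gt0 k) nu_gt0 eta_le.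
rewrite -xsE -[_ *: _ + _]/(xhat k t.+1 w) => step.
have {}step := step (favg_descent cX N_gt0 hf pdH nu_gt0 (@lip) Xh Xs1)
   (favg_grad_le hf Xh Xs) (favg_grad_le hf Xh Xst)
   (@inner_optimality k t.+1 w xst tm Xst).
apply: (le_trans step); rewrite iota1S big_cat/= big_seq1 [leRHS]addrA lerD2r.
by apply: ih; rewrite ltnW.
Qed.

(** The end of the inner loop, divided by [weight k]. The vector [hk] contains the penalty gradient
    at x_k; moving it to x_{k+1} turns the multiplier into [lam_tilde] and M_k into M_k - beta A^T
    A. *)
Lemma inner_result k w : (1 <= k)%N ->
  favg fs (x k.+1 w) - favg fs xst - ip (lam_tilde k w) (A *m (x k.+1 w - xst))
   + ip ((M k - beta *: (A^T *m A)) *m (x k.+1 w - x k w)) (x k.+1 w - xst)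
   + 1 / (etak k * weight k) * gnorm2 H (xb k.+1 w - xst) <=
  1 / (etak k * weight k) * gnorm2 H (xb k w - xst)
   + 1 / weight k * \sum_(i <- iota 1 (mk k)) noise_term k i w.
Proof.
move=> k1; have [_ _ _ /(_ k) [xE xbE] _] := run w.
have := @inner_loop k w (mk k) k1 (leqnn _); rewrite -xE -xbE.
have e0 := etak_gt0 c3 rho c1_gt0 c2_gt0 m_gt0 k.
have w0 := weight_gt0 c3 rho m_gt0 k.
have w1 : 0 <= 1 / weight k by rewrite divr_ge0 ?ltW.
move=> /(ler_wpM2l w1); rewrite -/(weight k).
have eL (p q : R) : 1 / weight k * (weight k * p + 1 / etak k * q) = p + 1 / (etak k * weight k) * q.
  by field; rewrite !gt_eqF.
have eR (p q : R) : 1 / weight k * (1 / etak k * p + q) = 1 / (etak k * weight k) * p + 1 / weight k * q.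
  by field; rewrite !gt_eqF.
rewrite eL eR; apply: le_trans; rewrite lerD2r /inner_gap.
rewrite -addrA lerD2l -subr_ge0.
suff -> : ip (hk k w + M k *m (x k.+1 w - x k w)) (x k.+1 w - xst) =
   - ip (lam_tilde k w) (A *m (x k.+1 w - xst)) +
   ip ((M k - beta *: (A^T *m A)) *m (x k.+1 w - x k w)) (x k.+1 w - xst) by rewrite subrr.
have -> : hk k w + M k *m (x k.+1 w - x k w) =
   - (A^T *m lam_tilde k w) + (M k - beta *: (A^T *m A)) *m (x k.+1 w - x k w).
  rewrite /Defs.hk /lam_tilde mulmxBl -scalemxAl -mulmxA !mulmxBr -!scalemxAr !mulmxBr !mulmxDr.
  move: (M k *m x k.+1 w) (M k *m x k w) (A^T *m lam k w) (A^T *m (A *m x k w)).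
  by move: (A^T *m (A *m x k.+1 w)) (A^T *m (B *m y k w)) (A^T *m b) => *; mxring.
by rewrite ipDl ipNl ip_mulmx trmxK.
Qed.
End Comparator.

(** * The y-step and the multiplier update *)

Lemma y_mem k w : Y (y k.+1 w).
Proof. by have [_ _ _ _ /(_ k) [[]]] := run w. Qed.

(** The gradient at y_{k+1} of the smooth part of the y-subproblem. *)
Definition y_grad k w : 'cV[R]_n2 :=
  B^T *m (beta *: resid (x k.+1 w) (y k.+1 w) - lam_half k w) + L *m (y k.+1 w - y k w).

Lemma y_optimality k w z : Y z -> g z \is a fin_num ->
  g (y k.+1 w) \is a fin_num /\
  0 <= fine (g z) - fine (g (y k.+1 w)) + ip (y_grad k w) (z - y k.+1 w).
Proof.
move=> Yz gz; have [_ _ _ _ /(_ k) [ymin _]] := run w.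
pose phi (v : 'cV[R]_n2) : R := favg fs (x k.+1 w) - ip (lam_half k w) (resid (x k.+1 w) v)
  + beta / 2 * ip (resid (x k.+1 w) v) (resid (x k.+1 w) v) + 1 / 2 * gnorm2 L (v - y k w).
have am : is_argmin_ext Y (fun v => g v + (phi v)%:E)%E (y k.+1 w).
  move: ymin; congr (is_argmin_ext Y _ _); apply/funext => v.
  rewrite /Lagb /Lag /Fobj vnormE /phi -/(lam_half k w).
  by case: (g v) => [r| |]//; rewrite -!EFinD; congr (_%:E); ring.
have [sL _] := psdL.
pose c v := beta / 2 * ip (B *m (v - y k.+1 w)) (B *m (v - y k.+1 w))
  + 1 / 2 * gnorm2 L (v - y k.+1 w).
apply: (prox_optimality_ext (phi := phi) (c := c) cY gY am _ Yz gz) => v t.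
rewrite /phi /c.
have -> : resid (x k.+1 w) (y k.+1 w + t *: (v - y k.+1 w)) =
   resid (x k.+1 w) (y k.+1 w) + t *: (B *m (v - y k.+1 w)).
  by rewrite /Defs.resid mulmxDr -scalemxAr; mxring.
have -> : y k.+1 w + t *: (v - y k.+1 w) - y k w = (y k.+1 w - y k w) + t *: (v - y k.+1 w).
  by rewrite addrAC.
rewrite (@gnorm2D _ _ L (y k.+1 w - y k w))// gnorm2Z -scalemxAr ipZr.
have -> : ip (y_grad k w) (v - y k.+1 w) =
    beta * ip (resid (x k.+1 w) (y k.+1 w)) (B *m (v - y k.+1 w))
    - ip (lam_half k w) (B *m (v - y k.+1 w)) + ip (y k.+1 w - y k w) (L *m (v - y k.+1 w)).
  rewrite /y_grad (ipDl (B^T *m _)) ip_mulmx trmxK (ip_sym _ _ sL) (ipDl (beta *: _)) ipNl ipZl.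
  by [].
move: (resid _ _) (B *m _) (lam_half k w) (gnorm2 L _) (gnorm2 L _) (ip _ (L *m _)).
move=> r0 d0 l0 g1 g2 i0.
by rewrite !(ipDl, ipDr, ipZl, ipZr) (ipC d0 r0); lra.
Qed.

Lemma y_fin k w : g (y k.+1 w) \is a fin_num.
Proof.
have [_ [y1 [Yy1 gy1]] _] := gY.
by have [] := y_optimality k w Yy1 gy1.
Qed.

Lemma lam_step k w : lam k.+1 w = lam k w
  - (tau * beta) *: (A *m x k.+1 w + B *m y k w - b) - (s * beta) *: resid (x k.+1 w) (y k.+1 w).
Proof. by have [_ _ _ _ /(_ k) [_ ->]] := run w. Qed.

(** Two successive y-steps, each optimality condition tested at the solution of the other: the
    values of [g] cancel in the sum, and the mixed [L]-term is at most half the sum of the squares.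
    The result has the form that [admm_crossing] requires. *)
Lemma y_crossing k w :
  1 / 2 * gnorm2 L (y k.+2 w - y k.+1 w) - 1 / 2 * gnorm2 L (y k.+1 w - y k w) <=
  beta * ip (B *m (y k.+2 w - y k.+1 w))
    ((1 - s) *: resid (x k.+1 w) (y k.+1 w) - (1 + tau) *: resid (x k.+2 w) (y k.+2 w)
     + tau *: (B *m (y k.+2 w - y k.+1 w))).
Proof.
set r := resid (x k.+2 w) _; set r0 := resid (x k.+1 w) _; set u := B *m _.
have [_ o1] := y_optimality k.+1 w (y_mem k w) (y_fin k w).
have [_ o2] := y_optimality k w (y_mem k.+1 w) (y_fin k.+1 w).
have [sL pL] := psdL.
have ly := pL ((y k.+1 w - y k w) - (y k.+2 w - y k.+1 w)).
rewrite (@gnorm2D _ _ L (y k.+1 w - y k w))// gnorm2N mulmxN ipNr in ly.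
have gE : ip (y_grad k w - y_grad k.+1 w) (y k.+2 w - y k.+1 w) =
   beta * ip u ((1 - s) *: r0 - (1 + tau) *: r + tau *: u)
   + ip (y k.+1 w - y k w) (L *m (y k.+2 w - y k.+1 w)) - gnorm2 L (y k.+2 w - y k.+1 w).
  have -> : y_grad k w - y_grad k.+1 w =
     B^T *m (beta *: ((1 - s) *: r0 - (1 + tau) *: r + tau *: u))
      + L *m (y k.+1 w - y k w) - L *m (y k.+2 w - y k.+1 w).
    have split4 (p q p' q' : 'cV[R]_n2) : p + q - (p' + q') = (p - p') + q - q' by mxring.
    rewrite /y_grad split4 -mulmxBr; congr (_ *m _ + _ - _).
    rewrite -/r -/r0.
    have -> : lam_half k.+1 w = lam k.+1 w - (tau * beta) *: (r - u).
      rewrite /Defs.lam_half; congr (_ - _ *: _).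
      by rewrite /r /u /Defs.resid mulmxBr; move: (A *m _) (B *m _) (B *m _) => *; mxring.
    rewrite lam_step -/r0 -/(lam_half k w).
    by move: (lam_half k w) r r0 u => *; mxring.
  rewrite (ipDl (_ + L *m _)) (ipDl (B^T *m _)) ipNl ip_mulmx trmxK (ipZl beta).
  rewrite !(ip_sym _ _ sL) -gnorm2E.
  by rewrite (ipC u).
have sE : ip (y_grad k w) (y k.+2 w - y k.+1 w) + ip (y_grad k.+1 w) (y k.+1 w - y k.+2 w) =
   beta * ip u ((1 - s) *: r0 - (1 + tau) *: r + tau *: u)
   + ip (y k.+1 w - y k w) (L *m (y k.+2 w - y k.+1 w)) - gnorm2 L (y k.+2 w - y k.+1 w).
  by rewrite -gE ipDl ipNl -[in ip (y_grad k.+1 w) _]opprB ipNr.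
lra.
Qed.

(** * The potential and the pathwise estimate *)

Section Lyapunov.
Variables (xst : 'cV[R]_n1) (yst : 'cV[R]_n2) (lst : 'cV[R]_n).
Hypothesis sp : saddle_point A B b fs g X Y xst yst lst.
Hypothesis kappa_gt0 : (1 <= kappa)%N.
Hypothesis hD : forall k, (kappa <= k)%N ->
  loewner_ge (M k - beta *: (A^T *m A)) (M k.+1 - beta *: (A^T *m A)).

Let Xst : X xst. Proof. by case: sp. Qed.
Let Yst : Y yst. Proof. by case: sp. Qed.

Definition prox_mx k : 'M[R]_n1 := M k - beta *: (A^T *m A).

(** The part free of the multiplier. Its last two terms are those that [admm_crossing] hands from
    one step to the next; the last reaches back to y_{k-1}, whence the moment of y at kappa - 1. *)
Definition potential_base k w : R :=
  1 / (etak k * weight k) * gnorm2 H (xb k w - xst)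
  + 1 / 2 * gnorm2 (prox_mx k) (x k w - xst)
  + 1 / 2 * gnorm2 L (y k w - yst)
  + beta / 2 * ((s - 1) ^+ 2 / (1 + tau)) * ip (resid (x k w) (y k w)) (resid (x k w) (y k w))
  + (1 - tau) / (1 + tau) * (1 / 2 * gnorm2 L (y k w - y k.-1 w)).

Definition potential k w (l : 'cV[R]_n) : R :=
  potential_base k w + 1 / 2 * admm_form beta tau s (B *m (y k w - yst)) (lam k w - l).

Definition noise k w : R := 1 / weight k * \sum_(i <- iota 1 (mk k)) noise_term xst k i w.

Definition gap (xx : 'cV[R]_n1) (yy : 'cV[R]_n2) (l : 'cV[R]_n) : R :=
  favg fs xx + fine (g yy) - (favg fs xst + fine (g yst)) - ip l (resid xx yy).

Lemma resid_saddle xx yy : resid xx yy = A *m (xx - xst) + B *m (yy - yst).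
Proof.
have r0 := saddle_resid gY sp.
rewrite -[LHS]subr0 -[X in _ - X]r0 /Defs.resid !mulmxBr.
by move: (A *m xx) (A *m xst) (B *m yy) (B *m yst) => *; mxring.
Qed.

Lemma potential_ge0 k w l : 0 <= potential k w l.
Proof.
have t1 := in_Delta_gtN1 Dts; have [ts tau1 _] := Dts.
have [_ pH] := pd_psd pdH; have [_ pL] := psdL; have [_ [_ pD]] := hM k.
have e0 := etak_gt0 c3 rho c1_gt0 c2_gt0 m_gt0 k; have w0 := weight_gt0 c3 rho m_gt0 k.
have h2 : 0 <= 1 / 2 :> R by lra.
have form0 := admm_form_ge0 beta_gt0 Dts.
have h3 : 0 <= (s - 1) ^+ 2 / (1 + tau) by rewrite divr_ge0 ?sqr_ge0 ?(ltW t1).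
have h4 : 0 <= (1 - tau) / (1 + tau) by rewrite divr_ge0 ?subr_ge0 ?(ltW t1).
have h5 : 0 <= 1 / (etak k * weight k) by rewrite divr_ge0 ?mulr_ge0 ?(ltW e0) ?(ltW w0).
have h6 : 0 <= beta / 2 by rewrite divr_ge0 ?ltW.
have [D1 D2] := (pD (x k w - xst), pL (y k w - yst)).
have [D3 D4] := (pL (y k w - y k.-1 w), pH (xb k w - xst)).
have D5 := form0 _ (B *m (y k w - yst)) (lam k w - l).
rewrite /potential /potential_base; repeat apply: addr_ge0; apply: mulr_ge0 => //.
- exact: mulr_ge0.
- exact: ip_ge0.
- exact: mulr_ge0.
Qed.

(** The gap is split at [lam_tilde]: [inner_result] bounds the part in x and [y_optimality] the part
    in y. The remaining pairing of lam_tilde - l with the residual joins the cross terms of the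
    y-step to form the left side of [admm_form_step], whose leftover squares are bounded below by
    [admm_crossing]. *)
Lemma lyapunov_step k w l : (kappa <= k)%N ->
  gap (x k.+1 w) (y k.+1 w) l + potential k.+1 w l <= potential k w l + noise k w.
Proof.
move=> kk; have k1 : (1 <= k)%N by exact: leq_trans kk.
have t1 := in_Delta_gtN1 Dts; have [ts tau1 _] := Dts.
have [sL pL] := psdL; have [_ [sD pD]] := hM k; have [_ [sD' pD']] := hM k.+1.
have inner := inner_result Xst w k1.
have [_ yopt] := y_optimality k w Yst (saddle_fin gY sp).
have cross : 1 / 2 * gnorm2 L (y k.+1 w - y k w) - 1 / 2 * gnorm2 L (y k w - y k.-1 w) <=
  beta * ip (B *m (y k.+1 w - y k w))
    ((1 - s) *: resid (x k w) (y k w) - (1 + tau) *: resid (x k.+1 w) (y k.+1 w)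
     + tau *: (B *m (y k.+1 w - y k w))).
  (* Since k >= 1, there is a y-step that produced y_k, and it is compared with the one producing
     y_{k+1}. *)
  by case: (k) k1 => // j _; exact: y_crossing.
have /(admm_crossing beta_gt0 Dts) := cross.
set r := resid (x k.+1 w) (y k.+1 w); set r0 := resid (x k w) (y k w).
set u := B *m (y k.+1 w - y k w).
set ell := 1 / 2 * gnorm2 L (y k.+1 w - y k w) - _ => crossE.
pose a := A *m x k.+1 w + B *m y k w - b.
pose q := B *m (y k w - yst); pose p := lam k w - l.
have rE : a + u = r.
  by rewrite /a /u /r /Defs.resid mulmxBr; move: (A *m _) (B *m _) (B *m _) => *; mxring.
have aE : r - u = a by rewrite -rE; mxring.
have vE : B *m (y k.+1 w - yst) = q + u.
  by rewrite /q /u -mulmxDr; congr (_ *m _); mxring.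
have pE : lam k.+1 w - l = p - (tau * beta) *: a - (s * beta) *: (a + u).
  by rewrite lam_step -/a -/r rE /p; mxring.
have form := admm_form_step beta_gt0 Dts p q a u.
rewrite -vE -pE /= rE in form; rewrite aE in crossE.
have xD : ip (prox_mx k *m (x k.+1 w - x k w)) (x k.+1 w - xst) >=
    1 / 2 * gnorm2 (prox_mx k.+1) (x k.+1 w - xst) - 1 / 2 * gnorm2 (prox_mx k) (x k w - xst).
  rewrite gnorm2_three_points//.
  have := (hD kk).2 (x k.+1 w - xst); rewrite gnorm2_sub.
  have := pD (x k.+1 w - x k w); rewrite -!/(prox_mx _); lra.
have yL : ip (L *m (y k.+1 w - y k w)) (y k.+1 w - yst) >=
    1 / 2 * gnorm2 L (y k.+1 w - yst) - 1 / 2 * gnorm2 L (y k w - yst).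
  rewrite gnorm2_three_points//; have := pL (y k.+1 w - y k w); lra.
have lamtE : lam_tilde k w = lam k w - beta *: a by [].
have ygE : ip (y_grad k w) (yst - y k.+1 w) = ip (lam_tilde k w) (B *m (y k.+1 w - yst))
    - ip (B *m (y k.+1 w - yst)) ((tau * beta) *: a + beta *: u)
    - ip (L *m (y k.+1 w - y k w)) (y k.+1 w - yst).
  rewrite -(opprB (y k.+1 w)) ipNr /y_grad (ipDl (B^T *m _)) ip_mulmx trmxK opprD.
  congr (_ - _); rewrite (ipC (B *m (y k.+1 w - yst)) (_ + _)).
  rewrite -(ipNl (beta *: _ - _)) -(ipNl (_ + _)) -(ipDl (lam_tilde k w)); congr ip.
  rewrite lamtE -/r -rE /Defs.lam_half -/a.
  by move: (lam k w) => *; mxring.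
have gapE : gap (x k.+1 w) (y k.+1 w) l =
   (favg fs (x k.+1 w) - favg fs xst - ip (lam_tilde k w) (A *m (x k.+1 w - xst)))
   + (fine (g (y k.+1 w)) - fine (g yst) - ip (lam_tilde k w) (B *m (y k.+1 w - yst)))
   + ip (p - beta *: a) r.
  rewrite /gap -/r.
  have -> : p - beta *: a = lam_tilde k w - l by rewrite lamtE /p; mxring.
  rewrite (ipDl (lam_tilde k w)) ipNl.
  have -> : ip (lam_tilde k w) r =
     ip (lam_tilde k w) (A *m (x k.+1 w - xst)) + ip (lam_tilde k w) (B *m (y k.+1 w - yst)).
    by rewrite -ipDr /r resid_saddle.
  ring.
have wH : 1 / (etak k.+1 * weight k.+1) * gnorm2 H (xb k.+1 w - xst) <=
    1 / (etak k * weight k) * gnorm2 H (xb k.+1 w - xst).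
  by rewrite ler_wpM2r ?(pd_psd pdH).2// inv_etak_weight_le.
rewrite ygE in yopt; rewrite gapE /potential /potential_base /noise -/r -/r0 -/q -/p /=.
move: inner; rewrite -/(prox_mx k) => inner.
have ellE : (1 - tau) / (1 + tau) * ell = (1 - tau) / (1 + tau) * (1 / 2 * gnorm2 L (y k.+1 w - y k w))
   - (1 - tau) / (1 + tau) * (1 / 2 * gnorm2 L (y k w - y k.-1 w)) by rewrite /ell mulrBr.
rewrite ellE mulrBr in crossE.
lra.
Qed.

Lemma lyapunov_sum (n0 : nat) w l :
  \sum_(k <- iota kappa n0) gap (x k.+1 w) (y k.+1 w) l <=
  potential kappa w l + \sum_(k <- iota kappa n0) noise k w.
Proof.
suff : \sum_(k <- iota kappa n0) gap (x k.+1 w) (y k.+1 w) l + potential (kappa + n0) w l <=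
  potential kappa w l + \sum_(k <- iota kappa n0) noise k w.
  by apply: le_trans; rewrite lerDl potential_ge0.
elim: n0 => [|j ih]; first by rewrite !big_nil addn0 add0r addr0.
have -> : iota kappa j.+1 = iota kappa j ++ [:: (kappa + j)%N].
  by have := iotaD kappa j 1; rewrite addn1.
rewrite !big_cat !big_seq1/= addnS.
have := lyapunov_step w l (leq_addr j kappa); lra.
Qed.

Definition avg_x n0 w : 'cV[R]_n1 := n0%:R^-1 *: \sum_(k <- iota kappa n0) x k.+1 w.
Definition avg_y n0 w : 'cV[R]_n2 := n0%:R^-1 *: \sum_(k <- iota kappa n0) y k.+1 w.

Lemma gap_average n0 w l : (1 <= n0)%N ->
  [/\ X (avg_x n0 w), Y (avg_y n0 w), g (avg_y n0 w) \is a fin_num &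
  gap (avg_x n0 w) (avg_y n0 w) l <=
    n0%:R^-1 * \sum_(k <- iota kappa n0) gap (x k.+1 w) (y k.+1 w) l].
Proof.
move=> n1'.
have [Xa fa] := @jensen_average _ _ X (favg fs) (fun k => x k.+1 w) kappa n0
  (fun a c t Xa Xc t01 => conj (convex_setP cX Xa Xc t01) (favg_convex hf Xa Xc t01))
  (fun i _ => (outer_mem w (ltn0Sn i)).1) n1'.
have [gN _ gc] := gY.
have gcv a c t : (Y a /\ g a \is a fin_num) -> (Y c /\ g c \is a fin_num) -> 0 <= t <= 1 ->
    (Y (t *: a + (1 - t) *: c) /\ g (t *: a + (1 - t) *: c) \is a fin_num) /\
    fine (g (t *: a + (1 - t) *: c)) <= t * fine (g a) + (1 - t) * fine (g c).
  move=> [Ya ga] [Yc gcc] t01; have Yt := convex_setP cY Ya Yc t01.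
  have := gc _ _ _ Ya Yc t01; rewrite -(fineK ga) -(fineK gcc) -!EFinM -EFinD.
  by have := gN _ Yt; case: (g (t *: a + (1 - t) *: c)).
have [[Ya gya] fy] := @jensen_average _ _ [set z | Y z /\ g z \is a fin_num] (fine \o g)
  (fun k => y k.+1 w) kappa n0 gcv (fun i _ => conj (y_mem i w) (y_fin i w)) n1'.
split=> //; rewrite /gap !big_split/= !sumrN.
have np : n0%:R != 0 :> R by rewrite pnatr_eq0 -lt0n.
have cstE (c : R) : \sum_(k <- iota kappa n0) c = n0%:R * c.
  by rewrite big_const_seq count_predT size_iota iter_addr_0 mulr_natl.
have -> : ip l (resid (avg_x n0 w) (avg_y n0 w)) =
    n0%:R^-1 * \sum_(k <- iota kappa n0) ip l (resid (x k.+1 w) (y k.+1 w)).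
  under eq_bigr do rewrite ipC; rewrite -ip_suml -ipZl ipC; congr ip.
  rewrite /Defs.resid /avg_x /avg_y -!scalemxAr !mulmx_sumr big_split/= sumrN big_split/=.
  rewrite big_const_seq count_predT size_iota iter_addr_0 scalerBr scalerDr.
  by rewrite -[b *+ n0]scaler_nat scalerA mulVf// scale1r.
rewrite cstE !mulrBr mulrDr mulKf//.
by move: fa fy; rewrite /avg_x /avg_y /=; lra.
Qed.

(** A bound valid for all multipliers within distance 1 of [lst]. The squared norm of a sum is at
    most twice the sum of squares, which cancels the factor 1/2 of the form; the unit ball
    contributes 1/(beta (tau + s)). *)
Definition potential_bound w : R :=
  potential_base kappa w + admm_form beta tau s (B *m (y kappa w - yst)) (lam kappa w - lst)
  + 1 / (beta * (tau + s)).

Lemma potential_le_bound w (l : 'cV[R]_n) : ip (lst - l) (lst - l) <= 1 ->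
  potential kappa w l <= potential_bound w.
Proof.
move=> hl; have [ts tau1 _] := Dts; have bt0 : 0 < beta * (tau + s) by rewrite mulr_gt0.
rewrite /potential /potential_bound -[leRHS]addrA lerD2l /admm_form.
set q := B *m _.
have -> : lam kappa w - l - (tau * beta) *: q = (lam kappa w - lst - (tau * beta) *: q) + (lst - l).
  by mxring.
have := ip_sqrD_le (lam kappa w - lst - (tau * beta) *: q) (lst - l).
set p := ip (_ + _) _; set p1 := ip (lam kappa w - lst - _) _; set p2 := ip (lst - l) _ in hl * => hp.
have c0 : 0 <= 1 / (beta * (tau + s)) by rewrite divr_ge0 ?ltW.
have hp' : p <= 2 * p1 + 2 * 1 by lra.
have := ler_wpM2l c0 hp'; have : 0 <= beta * (1 - tau) * ip q q.
  by rewrite !mulr_ge0 ?ip_ge0 ?(ltW beta_gt0)// subr_ge0.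
lra.
Qed.

(* Testing the gap at the multiplier [lst - r / |r|], which depends on the sample point,
   turns the bound on the gap into a bound on the norm of the residual [r]. *)
Lemma pathwise_bound n0 w : (1 <= n0)%N ->
  let U := n0%:R^-1 * (potential_bound w + \sum_(k <- iota kappa n0) noise k w) in
  vnorm (resid (avg_x n0 w) (avg_y n0 w)) <= U /\
  exists2 F : R, Fobj fs g (avg_x n0 w) (avg_y n0 w) = F%:E &
   `|F - (favg fs xst + fine (g yst))| <= (1 + vnorm lst) * U.
Proof.
move=> n1' U; set r := resid _ _.
pose l := lst - (vnorm r)^-1 *: r.
have [Xa Ya ga gp] := gap_average w l n1'.
have np : 0 < n0%:R :> R by rewrite ltr0n.
have lE : lst - l = (vnorm r)^-1 *: r by rewrite /l; mxring.
have hl : ip (lst - l) (lst - l) <= 1.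
  rewrite lE ipZl ipZr -vnormE expr2.
  (* For r = 0 the inverse of the norm is 0, so l = lst. *)
  by have [->|v0] := eqVneq (vnorm r) 0; [rewrite !mulr0 | rewrite mulKf ?mulVf].
have gU : gap (avg_x n0 w) (avg_y n0 w) l <= U.
  apply: (le_trans gp); rewrite ler_wpM2l ?invr_ge0 ?(ltW np)//.
  by apply: (le_trans (lyapunov_sum n0 w l)); rewrite lerD2r potential_le_bound.
have := saddle_ge gY sp Xa Ya ga; rewrite -/r.
move: gU; rewrite /gap -/r {1}/l ipDl ipNl ipZl -vnormE expr2.
have -> : (vnorm r)^-1 * (vnorm r * vnorm r) = vnorm r.
  by have [->|v0] := eqVneq (vnorm r) 0; rewrite ?mulr0// mulKf.
have v0 := vnorm_ge0 r; have ls0 := vnorm_ge0 lst.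
move: (ip_cauchy lst r); rewrite ler_norml => /andP[c1' c2'].
(* The gap at [l] is the gap at [lst] plus |r|, and the saddle property makes the latter gap
   nonnegative. *)
move=> h1 h2; have rU : vnorm r <= U by lra.
split=> //; exists (favg fs (avg_x n0 w) + fine (g (avg_y n0 w))).
  by rewrite /Fobj -[in LHS](fineK ga) -EFinD.
have := ler_wpM2l ls0 rU.
by rewrite ler_norml => h3; apply/andP; split; lra.
Qed.

(** Optimality of y_{k+1} tested at [yst], with the values of [g] removed by the saddle inequality
    at (xst, y_{k+1}). Young's inequality then gives up half of the quadratic penalty term. It
    serves to carry second moments through the y-step. *)
Lemma y_step_bound k w (c0 : 'cV[R]_n) :
  c0 = lam_half k w - lst - beta *: (A *m (x k.+1 w - xst)) ->
  beta / 2 * ip (B *m (y k.+1 w - yst)) (B *m (y k.+1 w - yst))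
   + 1 / 2 * gnorm2 L (y k.+1 w - yst) <=
  1 / (2 * beta) * ip c0 c0 + 1 / 2 * gnorm2 L (y k w - yst).
Proof.
move=> c0E; have [sL pL] := psdL.
have [_ yopt] := y_optimality k w Yst (saddle_fin gY sp).
have := saddle_ge gY sp Xst (y_mem k w) (y_fin k w); rewrite resid_saddle subrr mulmx0 add0r.
rewrite -(opprB (y k.+1 w)) ipNr /y_grad (ipDl (B^T *m _)) ip_mulmx trmxK in yopt.
rewrite gnorm2_three_points// in yopt.
have yg : beta *: resid (x k.+1 w) (y k.+1 w) - lam_half k w =
    beta *: (B *m (y k.+1 w - yst)) - lst - c0.
  by rewrite resid_saddle c0E; move: (A *m _) (B *m _) => *; mxring.
rewrite yg !(ipDl (_ + _)) !ipNl (ipDl (beta *: _)) ipNl ipZl in yopt.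
have := ip_young c0 (B *m (y k.+1 w - yst)) (_ : 0 < 1 / beta).
rewrite divr_gt0// => /(_ isT); have -> : 1 / (2 * (1 / beta)) = beta / 2.
  by field; rewrite gt_eqF.
have -> : 1 / beta / 2 = 1 / (2 * beta) by field; rewrite gt_eqF.
have := pL (y k.+1 w - y k w); lra.
Qed.

End Lyapunov.

(** * The past of a draw, and the sampling error *)

Section Randomness.
Hypothesis mxi : forall k t j, measurable [set w | xi k t w = j].
Hypothesis me : forall k t, rvec (e k t).
Hypothesis mouter : forall k, [/\ rvec (x k), rvec (xb k), rvec (y k) & rvec (lam k)].
Hypothesis minner : forall k t, rvec (xs k t) /\ rvec (xbs k t).
Hypothesis hxi : forall k t, (1 <= t <= mk k)%N -> forall j E,
  past mk xi e x xb y lam xs xbs k t E ->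
  P (E `&` [set w | xi k t w = j]) = ((N%:R)^-1%:E * P E)%E.
Hypothesis he : forall k t, (1 <= t <= mk k)%N -> forall i,
  P.-integrable setT (fun w => (e k t w i 0)%:E) /\
  forall E, past_xi mk xi e x xb y lam xs xbs k t E ->
    (\int[P]_(w in E) (e k t w i 0)%:E = 0)%E.

Local Notation pgen k t := (past_gen mk xi e x xb y lam xs xbs k t).

Lemma past_measurable k t E : <<s pgen k t >> E -> measurable E.
Proof.
apply: smallest_sub; first exact: sigma_algebra_measurable.
have mv n' (v : T -> 'cV[R]_n') : rvec v -> forall F, vec_events v F -> measurable F.
  by move=> mv F [i [Bs [mBs ->]]]; rewrite -[_ @^-1` _]setTI; exact: mv.
move=> F [[[k' [t' [_ _ [eF|[j ->]]]]]|[j [_]]]|[s' [_]]].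
- exact: mv (me k' t') _ eF.
- exact: mxi.
- have [m1 m2 m3 m4] := mouter j.
  by case=> hF; apply: mv hF.
- have [m1 m2] := minner k s'.
  by case=> hF; apply: mv hF.
Qed.

Section PastMeasurable.
Variables k t : nat.
Let T' : measurableType _ := g_sigma_algebraType (pgen k t).

Lemma past_rvec : (1 <= t)%N -> @rvec R _ T' n1 (xs k t) /\ @rvec R _ T' n1 (xbs k t).
Proof.
move=> t1; split=> i _ F mF; rewrite setTI; apply: sub_sigma_algebra;
  right; exists t; split; rewrite ?t1 ?leqnn//; [left|right]; by exists i, F.
Qed.

Lemma past_xhat : (1 <= t)%N -> @rvec R _ T' n1 (xhat k t).
Proof.
by move=> t1; have [h1 h2] := past_rvec t1; apply: rvecD; exact: rvecZ.
Qed.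

Lemma past_grad j i : (1 <= k)%N -> (1 <= t <= mk k)%N ->
  measurable_fun [set: T'] (fun w : T' => grad (fs j) (xhat k t w) i 0).
Proof.
move=> k1 tm; have [_ [U [oU XU _ cU]]] := hf j.
apply: (@measurable_continuous_comp _ T' R n1 U (fun z => grad (fs j) z i 0) (xhat k t)) => //.
- move=> z /cU cz; apply: (cvg_comp (grad (fs j)) (fun v : 'cV[R]_n1 => v i 0) cz).
  exact: coord_continuous.
- by apply: past_xhat; case/andP: tm.
- by move=> w; apply: XU; exact: xhat_mem.
Qed.
End PastMeasurable.

(** Minus the centred indicator of the draw; it is bounded and integrates to zero over every event
    of the past. *)
Definition ind k t (j : 'I_N) w : R := N%:R^-1 - (xi k t w == j)%:R.

(** The gradient of the drawn component depends on the draw and on the past at once. Summing over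
    all indices separates the two: coefficients that see only the draw, gradients that see only the
    past. *)
Lemma deltaE k t w : (1 <= k)%N -> (1 <= t <= mk k)%N ->
  delta k t w = \sum_(j < N) ind k t j w *: grad (fs j) (xhat k t w) - e k t w.
Proof.
move=> k1 tm; have Xh := xhat_mem w k1 tm.
rewrite /Defs.delta (favg_grad hf Xh) /dir opprD addrA; congr (_ - _); symmetry.
under eq_bigr do rewrite /ind scalerBl; rewrite sumrB -scaler_sumr; congr (_ - _).
rewrite (bigD1 (xi k t w))//= eqxx scale1r big1 ?addr0// => j ji.
by rewrite eq_sym (negbTE ji) scale0r.
Qed.

Lemma ind_measurable k t (j : 'I_N) : measurable_fun setT (ind k t j).
Proof.
apply: measurable_funB => //.
rewrite (_ : (fun w => _) = \1_[set w | xi k t w = j]); first exact: measurable_indic.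
apply/funext => w; rewrite indicE; congr (_%:R); congr nat_of_bool.
by apply/eqP/idP => [h|/set_mem//]; exact: mem_set.
Qed.

Lemma ind_le1 k t j w : `|ind k t j w| <= 1.
Proof.
have h0 : 0 <= N%:R^-1 :> R by rewrite invr_ge0.
have h1 : N%:R^-1 <= 1 :> R by rewrite invf_le1 ?ler1n ?ltr0n.
by rewrite /ind ler_norml; case: eqP => _ /=; apply/andP; split; lra.
Qed.

Lemma ind_intg k t j : intg P (ind k t j).
Proof. exact: intg_le (ind_measurable k t j) (intg_cst P 1) (ind_le1 k t j). Qed.

Lemma ind_integral0 k t (j : 'I_N) E : (1 <= t <= mk k)%N -> <<s pgen k t >> E ->
  (\int[P]_(w in E) (ind k t j w)%:E = 0)%E.
Proof.
move=> tm pE; have mE := past_measurable pE.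
have indE w : ind k t j w = N%:R^-1 - \1_[set w | xi k t w = j] w.
  rewrite /ind indicE; congr (_ - _%:R); congr nat_of_bool.
  by apply/eqP/idP => [h|/set_mem//]; exact: mem_set.
under eq_integral do rewrite indE EFinB.
rewrite (@integralB _ _ _ P E mE (cst (N%:R^-1)%:E)); first last.
- apply: (integrableS measurableT mE) => //.
  apply: (intg_le _ (intg_cst P 1)); first exact: measurable_indic.
  by move=> w; rewrite indicE; case: (_ \in _); rewrite ?normr1 ?normr0.
- exact: finite_measure_integrable_cst.
rewrite integral_cst// integral_indic//.
rewrite [X in (_ - X)%E](_ : _ = (N%:R^-1%:E * P E)%E); last by rewrite setIC; exact: hxi.
rewrite subee//.
by rewrite fin_numM// fin_num_measure.
Qed.

(** * Second moments along the run and the mean of the noise *)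

Section Moments.
Variables (xst : 'cV[R]_n1) (yst : 'cV[R]_n2) (lst : 'cV[R]_n) (sigma : R).
Hypothesis sp : saddle_point A B b fs g X Y xst yst lst.
Hypothesis kappa_gt0 : (1 <= kappa)%N.
Hypothesis hsigma : forall k t, (kappa <= k)%N -> (1 <= t <= mk k)%N ->
  (\int[P]_w (gnorm2 (invmx H) (delta k t w))%:E <= (sigma ^+ 2)%:E)%E.

Let Xst : X xst. Proof. by case: sp. Qed.

Lemma grad_measurable k t j : (1 <= k)%N -> (1 <= t <= mk k)%N ->
  rvec (fun w => grad (fs j) (xhat k t w)).
Proof.
move=> k1 tm i; apply: (@measurable_g_sigma _ _ _ (pgen k t)) => //.
  by move=> E; exact: past_measurable.
exact: past_grad.
Qed.

Lemma delta_measurable k t : (1 <= k)%N -> (1 <= t <= mk k)%N -> rvec (delta k t).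
Proof.
move=> k1 tm i; under eq_fun do rewrite deltaE// addmxE oppmxE summxE.
apply: measurable_funB; last exact: me.
apply: measurable_sum => j; under eq_fun do rewrite scalemxE.
by apply: measurable_funM; [exact: ind_measurable|exact: grad_measurable].
Qed.

Lemma delta_mean k t : (kappa <= k)%N -> (1 <= t <= mk k)%N ->
  mean_le P (fun w => gnorm2 (invmx H) (delta k t w)) (sigma ^+ 2).
Proof.
move=> kk tm; have k1 := leq_trans kappa_gt0 kk; split; last exact: hsigma.
apply: (intg_ge0 _ _ (hsigma kk tm)).
  by apply: rvec_gnorm2; exact: delta_measurable.
by move=> w; apply: (psd_invmx pdH).2.
Qed.

Lemma delta_vsqint k t : (kappa <= k)%N -> (1 <= t <= mk k)%N -> vsqint P (delta k t).
Proof.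
move=> kk tm; have k1 := leq_trans kappa_gt0 kk.
by apply: (vsqint_pd (pd_invmx pdH) (delta_measurable k1 tm) (delta_mean kk tm).1).
Qed.

(** By the Lipschitz condition the gradient differs from its constant value at [xst] by at most nu
    times the [H]-distance to [xst]. *)
Lemma grad_vsqint k t j : (1 <= k)%N -> (1 <= t <= mk k)%N -> vsqint P (xhat k t) ->
  vsqint P (fun w => grad (fs j) (xhat k t w)).
Proof.
move=> k1 tm sx.
have i1 := intgZ (nu ^+ 2) (vsqint_gnorm2 H (vsqintB sx (vsqint_cst P xst))).
have mv : rvec (fun w => grad (fs j) (xhat k t w) - grad (fs j) xst).
  apply: rvecD; [exact: grad_measurable|exact: rvec_cst].
have := vsqint_pd (pd_invmx pdH) mv i1 => h.
have -> : (fun w => grad (fs j) (xhat k t w)) =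
    (fun w => (grad (fs j) (xhat k t w) - grad (fs j) xst) + grad (fs j) xst).
  by apply/funext => w; rewrite subrK.
apply: vsqintD; last exact: vsqint_cst.
apply: h => w; have := @lip j _ _ (xhat_mem w k1 tm) Xst.
have p1 := (psd_invmx pdH).2 (grad (fs j) (xhat k t w) - grad (fs j) xst).
have p2 := (pd_psd pdH).2 (xhat k t w - xst).
rewrite -ler_sqr ?nnegrE ?mulr_ge0 ?sqrtr_ge0 ?(ltW nu_gt0)//.
by rewrite exprMn !sqr_sqrtr.
Qed.

(** The vector [c] is the gradient of the inner objective at [xst], and this objective is strongly
    convex with modulus gamma_t in the [H]-norm. *)
Lemma inner_step_bound k t w c : (1 <= t <= mk k)%N ->
  c = dir fs xi e xs xbs k t w + hk k w + gamma_t etak k t *: (H *m (xst - xbs k t w))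
      + M k *m (xst - x k w) ->
  gnorm2 H (xbs k t.+1 w - xst) <= (1 / gamma_t etak k t) ^+ 2 * gnorm2 (invmx H) c.
Proof.
move=> tm cE; have := inner_optimality w tm Xst.
set z := xbs k t.+1 w; set gam := gamma_t etak k t in cE *.
have gam0 : 0 < gam.
  rewrite /gam /gamma_t divr_gt0// mulr_gt0//; first by rewrite ltr0n; case/andP: tm.
  exact: (etak_gt0 c3 rho c1_gt0 c2_gt0 m_gt0).
have -> : dir fs xi e xs xbs k t w + hk k w + gam *: (H *m (z - xbs k t w)) + M k *m (z - x k w)
   = c + gam *: (H *m (z - xst)) + M k *m (z - xst).
  rewrite cE !mulmxBr.
  move: (H *m z) (H *m xst) (H *m xbs k t w) (M k *m z) (M k *m xst) (M k *m x k w).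
  by move=> *; mxring.
rewrite -(opprB z) ipNr (ipDl (_ + _)) (ipDl c) ipZl ![ip (_ *m _) _]ipC -!gnorm2E.
have := (psd_M k).2 (z - xst); have := pd_young (- c) (z - xst) pdH gam0.
rewrite gnorm2N ipNl => h1 h2 h3.
have h4 : gam / 2 * gnorm2 H (z - xst) <= 1 / (2 * gam) * gnorm2 (invmx H) c by lra.
have h5 : 0 <= 2 / gam by rewrite divr_ge0// ltW.
have := ler_wpM2l h5 h4.
have -> : 2 / gam * (gam / 2 * gnorm2 H (z - xst)) = gnorm2 H (z - xst) by field; rewrite gt_eqF.
congr (_ <= _); by field; rewrite gt_eqF.
Qed.

(** The invariant carried along the run; y appears only through the quantities that [y_step_bound]
    controls. *)
Definition moments k : Prop :=
  [/\ vsqint P (x k), vsqint P (xb k), vsqint P (fun w => B *m y k w), vsqint P (lam k) &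
      intg P (fun w => gnorm2 L (y k w - yst))].

Lemma inner_moments k t : (kappa <= k)%N -> moments k -> (1 <= t <= (mk k).+1)%N ->
  vsqint P (xs k t) /\ vsqint P (xbs k t).
Proof.
move=> kk [sx sxb sBy sl _]; have k1 := leq_trans kappa_gt0 kk.
elim: t => // t ih /andP[_ tm]; have [t0|t0] := posnP t.
  have e1 : xs k t.+1 = x k by apply/funext => w; rewrite t0; have [_ /(_ k) []] := run w.
  have e2 : xbs k t.+1 = xb k by apply/funext => w; rewrite t0; have [_ /(_ k) []] := run w.
  by rewrite e1 e2.
have [|s1 s2] := ih; first by rewrite t0 ltnW.
have tm' : (1 <= t <= mk k)%N by rewrite t0.
have sh : vsqint P (xhat k t) by apply: vsqintD; exact: vsqintZ.
(* The second moment of the direction comes from writing it as the exact gradient minus [delta],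
   whose moment is bounded by assumption. *)
have sd : vsqint P (dir fs xi e xs xbs k t).
  have -> : dir fs xi e xs xbs k t = (fun w =>
      N%:R^-1 *: \sum_(j < N) grad (fs j) (xhat k t w) - delta k t w).
    apply/funext => w; rewrite -(favg_grad hf (xhat_mem w k1 tm')) /Defs.delta.
    by rewrite subKr.
  apply: vsqintB; last exact: delta_vsqint.
  apply: vsqintZ => i; under eq_fun do rewrite summxE.
  by apply: sqint_sum => j; exact: grad_vsqint.
have shk : vsqint P (hk k).
  apply: vsqintN; apply: vsqintM; apply: vsqintB => //; apply: vsqintZ.
  by apply: vsqintB; [apply: vsqintD => //; exact: vsqintM|exact: vsqint_cst].
pose c w := dir fs xi e xs xbs k t w + hk k w + gamma_t etak k t *: (H *m (xst - xbs k t w))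
      + M k *m (xst - x k w).
have sc : vsqint P c.
  apply: vsqintD; last by apply: vsqintM; apply: vsqintB => //; exact: vsqint_cst.
  apply: vsqintD; first exact: vsqintD.
  by apply: vsqintZ; apply: vsqintM; apply: vsqintB => //; exact: vsqint_cst.
have sxb' : vsqint P (xbs k t.+1).
  have -> : xbs k t.+1 = (fun w => (xbs k t.+1 w - xst) + xst).
    by apply/funext => w; rewrite subrK.
  apply: vsqintD; last exact: vsqint_cst.
  have ic := intgZ ((1 / gamma_t etak k t) ^+ 2) (vsqint_gnorm2 (invmx H) sc).
  apply: (vsqint_pd pdH _ ic).
    by apply: rvecD; [exact: (minner k t.+1).2|exact: rvec_cst].
  by move=> w; apply: inner_step_bound.
split=> //.
have -> : xs k t.+1 = (fun w => beta_t R t *: xbs k t.+1 w + (1 - beta_t R t) *: xs k t w).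
  by apply/funext => w; have [_ _ /(_ k t tm') [_ ->]] := run w.
by apply: vsqintD; exact: vsqintZ.
Qed.

Lemma moments_step k : (kappa <= k)%N -> moments k -> moments k.+1.
Proof.
move=> kk mo; have [sx sxb sBy sl iL] := mo.
have [s1 s2] : vsqint P (xs k (mk k).+1) /\ vsqint P (xbs k (mk k).+1).
  by apply: inner_moments => //=; rewrite leqnn.
have e1 : x k.+1 = xs k (mk k).+1.
  by apply/funext => w; have [_ _ _ /(_ k) []] := run w.
have e2 : xb k.+1 = xbs k (mk k).+1.
  by apply/funext => w; have [_ _ _ /(_ k) []] := run w.
have sx' : vsqint P (x k.+1) by rewrite e1.
have sh : vsqint P (lam_half k).
  apply: vsqintB => //; apply: vsqintZ.
  by apply: vsqintB; [apply: vsqintD => //; exact: vsqintM|exact: vsqint_cst].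
pose c0 w := lam_half k w - lst - beta *: (A *m (x k.+1 w - xst)).
have sc0 : vsqint P c0.
  apply: vsqintB; first by apply: vsqintB => //; exact: vsqint_cst.
  by apply: vsqintZ; apply: vsqintM; apply: vsqintB => //; exact: vsqint_cst.
have ib : intg P (fun w => 1 / (2 * beta) * ip (c0 w) (c0 w) + 1 / 2 * gnorm2 L (y k w - yst)).
  by apply: intgD; apply: intgZ => //; exact: vsqint_ip.
have [_ _ my _] := mouter k.+1.
have bound w := y_step_bound sp (erefl (c0 w)).
have [_ pL] := psdL.
have myy : rvec (fun w => y k.+1 w - yst) by apply: rvecD => //; exact: rvec_cst.
have sBy' : vsqint P (fun w => B *m (y k.+1 w - yst)).
  apply: (vsqint_le _ (intgZ (2 / beta) ib)); first exact: rvecM.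
  move=> w; have := bound w; have := pL (y k.+1 w - yst).
  have b2 : 0 <= 2 / beta by rewrite divr_ge0// ltW.
  move=> h1 h2; have h3 : beta / 2 * ip (B *m (y k.+1 w - yst)) (B *m (y k.+1 w - yst)) <=
    1 / (2 * beta) * ip (c0 w) (c0 w) + 1 / 2 * gnorm2 L (y k w - yst) by lra.
  have := ler_wpM2l b2 h3; congr (_ <= _); by field; rewrite gt_eqF.
have sBy2 : vsqint P (fun w => B *m y k.+1 w).
  have -> : (fun w => B *m y k.+1 w) = (fun w => B *m (y k.+1 w - yst) + B *m yst).
    by apply/funext => w; rewrite -mulmxDr subrK.
  by apply: vsqintD => //; exact: vsqint_cst.
split=> //; first by rewrite e2.
- have -> : lam k.+1 = (fun w => lam_half k w - (s * beta) *: (A *m x k.+1 w + B *m y k.+1 w - b)).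
    by apply/funext => w; rewrite lam_step.
  apply: vsqintB => //; apply: vsqintZ.
  by apply: vsqintB; [apply: vsqintD => //; exact: vsqintM|exact: vsqint_cst].
- apply: (intg_le _ (intgZ 2 ib)); first exact: rvec_gnorm2.
  move=> w; rewrite ger0_norm//; have := bound w.
  have := ip_ge0 (B *m (y k.+1 w - yst)); have : 0 <= beta / 2 by rewrite divr_ge0// ltW.
  move=> h1 h2; have := mulr_ge0 h1 h2; lra.
Qed.

Lemma moments_all k : moments kappa -> (kappa <= k)%N -> moments k.
Proof.
move=> m0 /subnKC <-; elim: (k - kappa)%N => [|j ih]; first by rewrite addn0.
by rewrite addnS; apply: moments_step => //; exact: leq_addr.
Qed.

(** By [deltaE] the pairing is a finite sum of products of a centred factor, [ind] or a coordinate
    of [e], with a past-measurable one. Square integrability makes each product integrable on its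
    own, so the integral may be split. *)
Lemma delta_orthogonal k t : (kappa <= k)%N -> moments k -> (1 <= t <= mk k)%N ->
  mean_le P (fun w => ip (delta k t w) (xbs k t w - xst)) 0.
Proof.
move=> kk mo tm; have k1 := leq_trans kappa_gt0 kk.
have t1 : (1 <= t)%N by case/andP: tm.
have [|s1 s2] := inner_moments kk mo (t := t).
  by rewrite t1 leqW//; case/andP: tm.
have sh : vsqint P (xhat k t) by apply: vsqintD; exact: vsqintZ.
have sd := delta_vsqint kk tm.
have sz : vsqint P (fun w => xbs k t w - xst) by apply: vsqintB => //; exact: vsqint_cst.
have sg j := grad_vsqint j k1 tm sh.
have pm E : <<s pgen k t >> E -> measurable E by exact: past_measurable.
have mz i : measurable_fun [set: g_sigma_algebraType (pgen k t)]
    (fun w => (xbs k t w - xst) i 0 : R).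
  under eq_fun do rewrite addmxE; apply: measurable_funD; last exact: measurable_cst.
  exact: (past_rvec k t1).2.
have si j i : sqint P (fun w => ind k t j w * grad (fs j) (xhat k t w) i 0).
  have [mg ig] := sg j i.
  apply: (sqint_le _ ig); first by apply: measurable_funM => //; exact: ind_measurable.
  move=> w; rewrite exprMn ler_piMl ?sqr_ge0// -real_normK ?num_real//.
  by rewrite expr_le1// ind_le1.
(* Solving [deltaE] for [e] gives its second moment from those of the gradients and of [delta]. *)
have eE w i : e k t w i 0 = \sum_(j < N) ind k t j w * grad (fs j) (xhat k t w) i 0
    - delta k t w i 0.
  rewrite deltaE// addmxE oppmxE summxE.
  rewrite [X in _ - (X - _)](eq_bigr (fun j => ind k t j w * grad (fs j) (xhat k t w) i 0)).
    by rewrite subKr.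
  by move=> j _; rewrite scalemxE.
have se i : sqint P (fun w => e k t w i 0).
  under eq_fun do rewrite eE; apply: sqintD; first exact: sqint_sum.
  have := sqintZ (-1) (sd i); congr sqint; by apply/funext => w; rewrite mulN1r.
split; first exact: vsqint_ip.
have -> : (fun w => (ip (delta k t w) (xbs k t w - xst))%:E) = (fun w => \sum_(i < n1)
    (\sum_(j < N) (ind k t j w * (grad (fs j) (xhat k t w) i 0 * (xbs k t w - xst) i 0))%:E
      - (e k t w i 0 * (xbs k t w - xst) i 0)%:E))%E.
  apply/funext => w; rewrite ipE -sumEFin; apply: eq_bigr => i _.
  rewrite sumEFin -EFinB; congr (_%:E).
  under eq_bigr do rewrite mulrA; by rewrite -mulr_suml -mulrBl eE subKr.
have i1 j i : intg P (fun w => ind k t j w * (grad (fs j) (xhat k t w) i 0 * (xbs k t w - xst) i 0)).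
  have := sqint_mul (si j i) (sz i); congr intg; by apply/funext => w; rewrite mulrA.
have i2 i : intg P (fun w => e k t w i 0 * (xbs k t w - xst) i 0) by exact: sqint_mul.
have z1 j i : (\int[P]_w (ind k t j w * (grad (fs j) (xhat k t w) i 0 * (xbs k t w - xst) i 0))%:E = 0)%E.
  apply: (integral_mul_eq0 pm (ind_intg k t j)) => //.
    by move=> E; exact: ind_integral0.
  by apply: measurable_funM => //; exact: past_grad.
have z2 i : (\int[P]_w (e k t w i 0 * (xbs k t w - xst) i 0)%:E = 0)%E.
  have [ie e0] := he tm i; apply: (integral_mul_eq0 pm ie) => // E pE; apply: e0.
  (* Events of the past also belong to the larger sigma-algebra that knows the current draw. *)
  by apply: sub_sigma_algebra2 pE => F; left.
rewrite integral_sum//; last first.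
  move=> i; apply: integrableB => //; first by apply: integrable_sum => // j _; exact: i1.
  exact: i2.
rewrite big1// => i _; rewrite integralB//; last 2 first.
- by apply: integrable_sum => // j _; exact: i1.
- exact: i2.
rewrite integral_sum//; last by move=> j; exact: i1.
by rewrite z2 big1 ?sube0// => j _; exact: z1.
Qed.

Lemma noise_mean k : (kappa <= k)%N -> moments k ->
  mean_le P (noise xst k) (sigma ^+ 2 * (c1 * (1 / (mk k)%:R))).
Proof.
move=> kk mo; have w0 := weight_gt0 c3 rho m_gt0 k.
have w1 : 0 <= 1 / weight k by rewrite divr_ge0// ltW.
have e0 := etak_gt0 c3 rho c1_gt0 c2_gt0 m_gt0 k.
have : mean_le P (noise xst k) (1 / weight k * \sum_(i <- iota 1 (mk k))
    (i%:R * 0 + i%:R ^+ 2 * etak k / 2 * sigma ^+ 2)).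
  apply: (mean_leZ w1); apply: mean_le_sum => t; rewrite mem_iota add1n ltnS => tm.
  apply: mean_leD; apply: mean_leZ => //.
  - exact: delta_orthogonal.
  - by rewrite divr_ge0// mulr_ge0 ?sqr_ge0// ltW.
  - exact: delta_mean.
apply: mean_le_trans; under eq_bigr do rewrite mulr0 add0r.
rewrite -mulr_suml [leLHS]mulrA [leLHS]mulrC ler_wpM2l ?sqr_ge0//.
exact: etak_sum_sqr_le.
Qed.

Hypothesis hD : forall k, (kappa <= k)%N ->
  loewner_ge (M k - beta *: (A^T *m A)) (M k.+1 - beta *: (A^T *m A)).
Hypotheses (sx : vsqint P (x kappa)) (sxb : vsqint P (xb kappa)) (sl : vsqint P (lam kappa)).
Hypotheses (sy : vsqint P (y kappa)) (sy' : vsqint P (y kappa.-1)).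

Lemma moments_kappa : moments kappa.
Proof.
split=> //; first exact: vsqintM.
by apply: vsqint_gnorm2; apply: vsqintB => //; exact: vsqint_cst.
Qed.

Lemma potential_bound_intg : intg P (potential_bound xst yst lst).
Proof.
have sq n' (u : T -> 'cV[R]_n') v : vsqint P u -> vsqint P (fun w => u w - v).
  by move=> su; apply: vsqintB => //; exact: vsqint_cst.
have sr : vsqint P (fun w => resid (x kappa w) (y kappa w)).
  by apply: sq; apply: vsqintD; exact: vsqintM.
have sBy : vsqint P (fun w => B *m (y kappa w - yst)) by apply: vsqintM; exact: sq.
apply: intgD; last exact: intg_cst.
apply: intgD; last first.
  apply: intgD; apply: intgZ; apply: vsqint_ip => //;
    by apply: vsqintB; [exact: sq|exact: vsqintZ].
apply: intgD; last by do 2 apply: intgZ; apply: vsqint_gnorm2; exact: vsqintB.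
apply: intgD; last by apply: intgZ; exact: vsqint_ip.
by repeat apply: intgD; apply: intgZ; apply: vsqint_gnorm2; exact: sq.
Qed.

Lemma convergence : exists C : R, 0 < C /\ forall n0 : nat, (1 <= n0)%N ->
  (`| \int[P]_w Fobj fs g (avg_x n0 w) (avg_y n0 w) - Fobj fs g xst yst |
     <= (C * Erho rho n0)%:E)%E /\
  (\int[P]_w (vnorm (resid (avg_x n0 w) (avg_y n0 w)))%:E <= (C * Erho rho n0)%:E)%E.
Proof.
have [K K0 hK] := sum_inv_mk_le c3_gt0 rho_ge1 m_gt0 kappa_gt0.
have [c0 hc0] := intg_mean_le potential_bound_intg.
(* The mean of the initial potential is at most c0, and the added 1 keeps the constant positive; the
   last summand is the accumulated quadratic noise. *)
pose C1 := `|c0| + 1 + sigma ^+ 2 * c1 * K.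
have sK : 0 <= sigma ^+ 2 * c1 * K by exact: mulr_ge0 (mulr_ge0 (sqr_ge0 _) (ltW c1_gt0)) (ltW K0).
have C1_gt0 : 0 < C1 by rewrite /C1 ltr_pwDl// ltr_wpDl.
have ls0 := vnorm_ge0 lst.
have ls1 : 0 < 1 + vnorm lst by rewrite ltr_pwDl.
(* The factor 1 + |lst| comes from the objective estimate; it is at least 1, so the residual is
   covered as well. *)
exists ((1 + vnorm lst) * C1); split; first exact: mulr_gt0.
move=> n0 n0_gt0; have np : 0 < n0%:R :> R by rewrite ltr0n.
have E1 := Erho_ge rho n0_gt0.
have E0 : 0 <= Erho rho n0 by rewrite -(pmulr_lge0 _ np) (le_trans ler01).
pose U w := n0%:R^-1 * (potential_bound xst yst lst w + \sum_(k <- iota kappa n0) noise xst k w).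
have meanU : mean_le P U (C1 * Erho rho n0).
  have ni0 : 0 <= n0%:R^-1 :> R by rewrite invr_ge0.
  have hs : mean_le P (fun w => \sum_(k <- iota kappa n0) noise xst k w)
      (\sum_(k <- iota kappa n0) sigma ^+ 2 * (c1 * (1 / (mk k)%:R))).
    apply: mean_le_sum => k; rewrite mem_iota => /andP[kk _].
    by apply: noise_mean => //; apply: moments_all => //; exact: moments_kappa.
  apply: mean_le_trans (mean_leZ ni0 (mean_leD hc0 hs)).
  rewrite ler_pdivrMl// -mulr_sumr -mulr_sumr.
  have sc : 0 <= sigma ^+ 2 * c1 by exact: mulr_ge0 (sqr_ge0 _) (ltW c1_gt0).
  have := ler_wpM2l sc (hK n0 n0_gt0).
  have c0' : 0 <= `|c0| + 1 by rewrite addr_ge0.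
  have := ler_wpM2l c0' E1; have := ler_norm c0.
  rewrite /C1; move: (\sum_(k <- _) _) => S h1 h2 h3.
  lra.
have path w := pathwise_bound sp kappa_gt0 hD w n0_gt0.
have E2 : C1 * Erho rho n0 <= (1 + vnorm lst) * C1 * Erho rho n0.
  by rewrite ler_wpM2r// ler_peMl ?(ltW C1_gt0)// lerDl.
split; last first.
  apply: (@integral_le_mean _ _ _ P _ U); last exact: mean_le_trans meanU.
  by move=> w; have [] := path w.
have -> : Fobj fs g xst yst = (favg fs xst + fine (g yst))%:E.
  by rewrite /Fobj -[in LHS](fineK (saddle_fin gY sp)) -EFinD.
apply: (@integral_near_cst _ _ _ P _ (fun w => (1 + vnorm lst) * U w)); last first.
  by rewrite -mulrA; apply: mean_leZ => //; exact: ltW.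
move=> w; have [_ [F -> hF]] := path w.
by rewrite !lee_fin -ler_distl.
Qed.
End Moments.
End Randomness.
End Run.

Unset Implicit Arguments.
Set Strict Implicit.
Set Printing Implicit Defensive.

Theorem theorem3p5
  (R : realType) (n1 n2 n N : nat)
  (X : set 'cV[R]_n1) (Y : set 'cV[R]_n2)
  (A : 'M[R]_(n, n1)) (B : 'M[R]_(n, n2)) (b : 'cV[R]_n)
  (fs : 'I_N -> 'cV[R]_n1 -> R) (g : 'cV[R]_n2 -> \bar R)
  (H : 'M[R]_n1) (nu : R)
  (beta : R) (L : 'M[R]_n2) (tau s : R)
  (c1 c2 c3 rho : R) (m kappa : nat) (sigma : R)
  (M : nat -> 'M[R]_n1)
  (d : measure_display) (T : measurableType d) (P : probability T R)
  (xi : nat -> nat -> T -> 'I_N) (e : nat -> nat -> T -> 'cV[R]_n1)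
  (x xb : nat -> T -> 'cV[R]_n1) (y : nat -> T -> 'cV[R]_n2)
  (lam : nat -> T -> 'cV[R]_n)
  (xs xbs : nat -> nat -> T -> 'cV[R]_n1)
  (x0 : 'cV[R]_n1) (y0 : 'cV[R]_n2) (lam0 : 'cV[R]_n) :
  (* standing assumptions of the problem *)
  (exists z, X z) -> closed X -> convex_set X ->
  (exists z, Y z) -> closed Y -> convex_set Y ->
  proper_convex_on Y g ->
  (0 < N)%N ->
  (forall j, convex_on X (fs j) /\ C1_near X (fs j)) ->
  (exists xs0 ys0 ls0, saddle_point A B b fs g X Y xs0 ys0 ls0) ->
  (forall z : 'cV[R]_n2, exists yz, is_argmin_ext Y
       (fun v => (g v + (1 / 2 * gnorm2 (B^T *m B) v + ip z v)%:E)%E) yz) ->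
  pd H -> 0 < nu ->
  (forall j x1 x2, X x1 -> X x2 ->
     Num.sqrt (gnorm2 (invmx H) (grad (fs j) x1 - grad (fs j) x2))
       <= nu * Num.sqrt (gnorm2 H (x1 - x2))) ->
  (* algorithm parameters *)
  0 < beta -> psd L -> in_Delta tau s ->
  0 < c1 -> 0 < c3 -> 0 < c2 -> c2 <= 1 / (2 * nu) -> 1 <= rho -> (1 <= m)%N ->
  (forall k, sym_mx (M k) /\ psd (M k - beta *: (A^T *m A))) ->
  (* the run of SAS-ADMM with m_k, eta_k as prescribed *)
  sas_admm_run X Y A B b fs g H beta L tau s (mk c3 rho m) (etak c1 c2 c3 rho m) M
    xi e x xb y lam xs xbs x0 y0 lam0 ->
  (* all generated quantities are random variables *)
  (forall k t j, measurable [set w | xi k t w = j]) ->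
  (forall k t, rvec (e k t)) ->
  (forall k, [/\ rvec (x k), rvec (xb k), rvec (y k) & rvec (lam k)]) ->
  (forall k t, rvec (xs k t) /\ rvec (xbs k t)) ->
  (* xi_t uniform on {1..N} and independent of everything generated before *)
  (forall k t, (1 <= t <= mk c3 rho m k)%N -> forall j E,
     past (mk c3 rho m) xi e x xb y lam xs xbs k t E ->
     P (E `&` [set w | xi k t w = j]) = ((N%:R)^-1%:E * P E)%E) ->
  (* E[e_t | past, xi_t] = 0 *)
  (forall k t, (1 <= t <= mk c3 rho m k)%N -> forall i,
     P.-integrable setT (fun w => (e k t w i 0)%:E) /\
     forall E, past_xi (mk c3 rho m) xi e x xb y lam xs xbs k t E ->
       (\int[P]_(w in E) (e k t w i 0)%:E = 0)%E) ->
  (* assumptions from iteration kappa on *)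
  (1 <= kappa)%N ->
  (forall k, (kappa <= k)%N ->
     loewner_ge (M k - beta *: (A^T *m A)) (M k.+1 - beta *: (A^T *m A)) /\
     psd (M k.+1 - beta *: (A^T *m A))) ->
  0 < sigma ->
  (forall k t, (kappa <= k)%N -> (1 <= t <= mk c3 rho m k)%N ->
     (\int[P]_w (gnorm2 (invmx H)
                  (delta fs xi e xs xbs k t w))%:E
        <= (sigma ^+ 2)%:E)%E) ->
  (\int[P]_w (vnorm (x kappa w) ^+ 2)%:E < +oo)%E ->
  (\int[P]_w (vnorm (xb kappa w) ^+ 2)%:E < +oo)%E ->
  (\int[P]_w (vnorm (y kappa.-1 w) ^+ 2)%:E < +oo)%E ->
  (\int[P]_w (vnorm (y kappa w) ^+ 2)%:E < +oo)%E ->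
  (\int[P]_w (vnorm (lam kappa w) ^+ 2)%:E < +oo)%E ->
  forall (xst : 'cV[R]_n1) (yst : 'cV[R]_n2) (lst : 'cV[R]_n),
    saddle_point A B b fs g X Y xst yst lst ->
    exists C : R, 0 < C /\
      forall Tn : nat, (1 <= Tn)%N ->
        let xT := fun w => Tn%:R^-1 *: \sum_(k <- iota kappa Tn) x k.+1 w in
        let yT := fun w => Tn%:R^-1 *: \sum_(k <- iota kappa Tn) y k.+1 w in
        (`| \int[P]_w Fobj fs g (xT w) (yT w) - Fobj fs g xst yst |
            <= (C * Erho rho Tn)%:E)%E /\
        (\int[P]_w (vnorm (resid A B b (xT w) (yT w)))%:E
            <= (C * Erho rho Tn)%:E)%E.
Proof.
move=> _ _ cX _ _ cY gY N_gt0 hf _ _ pdH nu_gt0 lip beta_gt0 psdL Dts.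
move=> c1_gt0 c3_gt0 c2_gt0 c2_le rho_ge1 m_gt0 hM run mxi me mouter minner hxi he.
move=> kappa_gt0 hD _ hsigma hx hxb hy' hy hlam xst yst lst sp.
have [mx mxb my ml] := mouter kappa.
have [_ _ my' _] := mouter kappa.-1.
apply: (@convergence R n1 n2 n N X Y A B b fs g H nu beta L tau s c1 c2 c3 rho m kappa
  M d T P xi e x xb y lam xs xbs x0 y0 lam0 cX cY gY N_gt0 hf pdH nu_gt0 lip beta_gt0
  psdL Dts c1_gt0 c3_gt0 c2_gt0 c2_le rho_ge1 m_gt0 hM run mxi me mouter minner hxi he
  xst yst lst sigma sp kappa_gt0 hsigma (fun k kk => (hD k kk).1));
  exact: vsqint_vnorm.
Qed.
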